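(* Let $A\in\mathbb{R}^{m\times n}$, $B\in\mathbb{R}^{\nu\times n}$ with $B\ne0$, $\sigma>0$, let $S$ be a symmetric positive semidefinite $n\times n$ matrix, and let $\mathcal{X}=\{x\in\mathbb{R}^n:\exists t\in\mathcal{T}:\ x^TS_kx\le t_k,\ 1\le k\le K\}$ be an ellitope (with $S_k$, $\mathcal{T}$ as in the context). Let $H_*$ be the $H$-component of an optimal solution to the convex optimization problem $$\min_{\tau,H,\lambda}\left\{\tau:\ \begin{bmatrix}\sum_k\lambda_kS_k+\tau S&B^T-A^TH\\ B-H^TA&I_\nu\end{bmatrix}\succeq0,\ \ \sigma^2\mathrm{Tr}(H^TH)+\phi_{\mathcal{T}}(\lambda)\le\tau,\ \ \lambda\ge0\right\}$$ with variables $\tau\in\mathbb{R}$, $H\in\mathbb{R}^{m\times\nu}$, $\lambda\in\mathbb{R}^K$. Then the linear estimate $\widehat{w}_{H_*}(\omega)=H_*^T\omega$ satisfies $$\mathrm{RiskS}[\widehat{w}_{H_*}|\mathcal{X}]\le\sqrt{6\ln\left(\frac{8KM_*^2}{\mathrm{RiskS}_{\mathrm{opt}}^2[\mathcal{X}]}\right)}\ \mathrm{RiskS}_{\mathrm{opt}}[\mathcal{X}],$$ where $M_*=\sqrt{\max_{Q\in\mathcal{Q}}\mathrm{Tr}(BQB^T)}$.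
   Context: Ellitope data: $S_1,\dots,S_K$ are symmetric positive semidefinite $n\times n$ matrices with $\sum_kS_k\succ0$; $\mathcal{T}\subset\mathbb{R}^K_+$ is a nonempty convex compact set which intersects the interior of $\mathbb{R}^K_+$ and is monotone ($0\le\tau\le t$ and $t\in\mathcal{T}$ imply $\tau\in\mathcal{T}$). $\phi_{\mathcal{T}}(\lambda)=\max_{t\in\mathcal{T}}\lambda^Tt$. $\mathcal{Q}=\{Q\in\mathbb{R}^{n\times n}\text{ symmetric}: Q\succeq0,\ \exists t\in\mathcal{T}:\ \mathrm{Tr}(QS_k)\le t_k,\ 1\le k\le K\}$. Observation model: $\omega=Ax+\sigma\xi$, $\xi\sim\mathcal{N}(0,I_m)$, with unknown $x\in\mathcal{X}$; the goal is to estimate $Bx$. An estimate is a Borel function $\widehat{w}:\mathbb{R}^m\to\mathbb{R}^\nu$. Its $S$-risk is $$\mathrm{RiskS}[\widehat{w}|\mathcal{X}]=\inf\left\{\sqrt{\tau}:\ \mathbf{E}_{\xi\sim\mathcal{N}(0,I_m)}\{\|\widehat{w}(Ax+\sigma\xi)-Bx\|_2^2\}\le\tau(1+x^TSx)\ \ \forall x\in\mathcal{X}\right\},$$ and $\mathrm{RiskS}_{\mathrm{opt}}[\mathcal{X}]=\inf_{\widehat{w}(\cdot)}\mathrm{RiskS}[\widehat{w}|\mathcal{X}]$, the infimum being over all Borel estimates. *)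

(* Defs.v *)
From HB Require Import structures.
From mathcomp Require Import all_boot all_order all_algebra.
From mathcomp Require Import all_classical all_reals all_analysis.

Set Implicit Arguments.
Unset Strict Implicit.
Unset Printing Implicit Defensive.

Import Order.TTheory GRing.Theory Num.Theory.
Import numFieldNormedType.Exports.

Local Open Scope classical_set_scope.
Local Open Scope ring_scope.

Section gaussian.
Context {R : realType}.

Definition tcons {m : nat}
    (p : measurableTypeR R * m.-tuple (measurableTypeR R)) :
    m.+1.-tuple (measurableTypeR R) := [tuple of p.1 :: p.2].

Lemma measurable_tcons m : measurable_fun [set: _] (@tcons m).
Proof. exact: measurable_cons. Qed.

HB.instance Definition _ m := isMeasurableFun.Build _ _ _ _ (@tcons m)
  (@measurable_tcons m).

(* N(0, I_m), built as the m-fold product of N(0, 1); it lives on m-tuples,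
   which the library equips with the product of the Borel sigma-algebras of R,
   so vectors are recovered through [col_of_tuple]. *)
Fixpoint std_gaussian (m : nat) :
    probability (m.-tuple (measurableTypeR R)) R :=
  match m with
  | 0 => dirac [tuple]
  | m'.+1 =>
      distribution (normal_prob 0 1 \x std_gaussian m')%E (@tcons m')
  end.

Definition col_of_tuple (m : nat) (t : m.-tuple (measurableTypeR R)) :
    'cV[R]_m := \col_i tnth t i.

End gaussian.

Section matrices.
Context {R : realType}.

Definition quad (n : nat) (M : 'M[R]_n) (x : 'cV[R]_n) : R :=
  (x^T *m M *m x) 0 0.

Definition psdmx (n : nat) (M : 'M[R]_n) : Prop :=
  M^T = M /\ forall x, 0 <= quad M x.

Definition pdmx (n : nat) (M : 'M[R]_n) : Prop :=
  M^T = M /\ forall x, x != 0 -> 0 < quad M x.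

(* The library's norm on matrices is the sup norm, hence this definition of
   the squared Euclidean norm. *)
Definition sqnorm2 (n : nat) (v : 'cV[R]_n) : R := \sum_i v i 0 ^+ 2.

Definition nneg_cV (K : nat) : set 'cV[R]_K := [set t | forall k, 0 <= t k 0].

End matrices.

Section ellitopes.
Context {R : realType} {n K : nat}.
Variables (S_ : 'I_K -> 'M[R]_n) (T : set 'cV[R]_K).

Record ellitope_data : Prop := EllitopeData {
  ell_psd : forall k, psdmx (S_ k);
  ell_sum_pd : pdmx (\sum_k S_ k);
  ell_nonempty : T !=set0;
  ell_nneg : T `<=` @nneg_cV R K;
  ell_convex : convex_set T;
  ell_compact : compact T;
  ell_interior : T `&` (@nneg_cV R K)° !=set0;
  ell_monotone : forall t tau : 'cV[R]_K,
    T t -> (forall k, 0 <= tau k 0 <= t k 0) -> T tau }.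

Definition ellitope : set 'cV[R]_n :=
  [set x | exists2 t, T t & forall k, quad (S_ k) x <= t k 0].

(* Under [ellitope_data], this supremum and the one defining [Mstar] are
   attained, i.e., they are maxima. *)
Definition phi (lambda : 'cV[R]_K) : R :=
  sup [set (lambda^T *m t) 0 0 | t in T].

Definition ellQ : set 'M[R]_n :=
  [set Q | psdmx Q /\ exists2 t, T t & forall k, \tr (Q *m S_ k) <= t k 0].

Definition Mstar (nu : nat) (B : 'M[R]_(nu, n)) : R :=
  Num.sqrt (sup [set \tr (B *m Q *m B^T) | Q in ellQ]).

End ellitopes.

Section risk.
Context {R : realType} {m n nu : nat}.

Definition borel_fun (w : 'cV[R]_m -> 'cV[R]_nu) : Prop :=
  measurable_fun [set: g_sigma_algebraType (@open 'cV[R]_m)]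
    (w : g_sigma_algebraType (@open 'cV[R]_m) ->
         g_sigma_algebraType (@open 'cV[R]_nu)).

Variables (A : 'M[R]_(m, n)) (B : 'M[R]_(nu, n)) (sigma : R) (S : 'M[R]_n)
  (X : set 'cV[R]_n).

Definition mse (w : 'cV[R]_m -> 'cV[R]_nu) (x : 'cV[R]_n) : \bar R :=
  (\int[std_gaussian m]_t
    (sqnorm2 (w (A *m x + sigma *: col_of_tuple t) - B *m x))%:E)%E.

(* Both risks are extended reals: an estimate may have infinite S-risk. *)
Definition RiskS (w : 'cV[R]_m -> 'cV[R]_nu) : \bar R :=
  ereal_inf [set (Num.sqrt tau)%:E | tau in
    [set tau : R |
      forall x, X x -> (mse w x <= (tau * (1 + quad S x))%:E)%E]].

Definition RiskSopt : \bar R := ereal_inf [set RiskS w | w in borel_fun].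

End risk.

Section design.
Context {R : realType} {m n nu K : nat}.
Variables (S_ : 'I_K -> 'M[R]_n) (T : set 'cV[R]_K).
Variables (A : 'M[R]_(m, n)) (B : 'M[R]_(nu, n)) (sigma : R) (S : 'M[R]_n).

Definition feasible (tau : R) (H : 'M[R]_(m, nu)) (lambda : 'cV[R]_K) : Prop :=
  [/\ psdmx (block_mx (\sum_k lambda k 0 *: S_ k + tau *: S)
                      (B^T - A^T *m H)
                      (B - H^T *m A)
                      (1%:M : 'M[R]_nu)),
      sigma ^+ 2 * \tr (H^T *m H) + phi T lambda <= tau
    & forall k, 0 <= lambda k 0].

Definition optimal (tau : R) (H : 'M[R]_(m, nu)) (lambda : 'cV[R]_K) : Prop :=
  feasible tau H lambda /\
  forall tau' H' lambda', feasible tau' H' lambda' -> tau <= tau'.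

Definition linear_estimate (H : 'M[R]_(m, nu)) (omega : 'cV[R]_m) :
  'cV[R]_nu := H^T *m omega.

End design.

(* Main.v *)
(**
The SDP is dual to a maximization over covariances: its optimal value [tau] is
the supremum over [Q] in [ellQ] of the minimal value, over linear filters [H],
of the mean squared error under a signal of covariance [Q], divided by
[1 + Tr(QS)].  This follows from a minimax argument in which the constraint
[Tr(QS_k) <= t_k] is penalized quadratically, so that the multipliers [lambda]
enter in a strongly convex way and no compactness of the set of covariances is
needed.

Feasibility of [(tau, H, lambda)] bounds the risk of the linear estimate by
[sqrt tau].  Conversely, let the signal be Gaussian with covariance [kap Q], [Q]
nearly dual optimal.  No estimate beats the best linear one in mean for this
prior, so its mean risk is at least [kap tau (1 + Tr(QS))]; replacing an
estimate by its projection onto the ball of radius [Mstar] does not increase its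
error on the signal set, and the signals outside that set then contribute at
most [4 sqrt 3 K Mstar^2 exp (-1/(3 kap))] to the mean risk.  The choice
[kap = 1 / (3 ln (8 K Mstar^2 / r^2))] gives the inequality.
*)

From HB Require Import structures.
Require Import Defs.
From mathcomp Require Import all_boot all_order all_algebra.
From mathcomp Require Import all_classical all_reals all_analysis.
From mathcomp Require Import measurable_realfun.
From mathcomp Require Import ring lra.

Set Implicit Arguments.
Unset Strict Implicit.
Unset Printing Implicit Defensive.

Import Order.TTheory GRing.Theory Num.Theory.
Import numFieldNormedType.Exports.

Local Open Scope classical_set_scope.
Local Open Scope ring_scope.

(** * Euclidean linear algebra *)

(** The lower bound compares with linear filters at a single covariance, whereas the SDP treats all
    signals at once; duality supplies that covariance. The dual optimum is only approached, never
    attained, and a signal must have strictly positive room in every constraint. Each of the two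
    approximations costs a factor 39/40, which fits between [3 * (1 + sqrt 3 / 2)], about 5.6, and
    the stated 6. The 3 in the exponent comes from [exp (g^2 / 3)], whose mean [sqrt 3] is finite
    because 1/3 < 1/2. Truncation is forced: a risk bound on the signal set says nothing about the
    error at the unbounded Gaussian signals outside it. Expectations are taken of nonnegative
    functions with extended values, so odd terms are removed by averaging over a reflection rather
    than by integrating them; the same reflection, about the posterior mean, replaces conditional
    expectations. The statement divides by the optimal risk. Its positivity follows from the same
    lower bound as [kap] tends to 0, since [exp (-1/(3 kap))] vanishes faster than [kap]. *)

Section euclidean.
Context {R : realType}.

Definition dot n (u v : 'cV[R]_n) : R := \sum_i u i 0 * v i 0.

Lemma dotC n (u v : 'cV[R]_n) : dot u v = dot v u.
Proof. by apply: eq_bigr => i _; rewrite mulrC. Qed.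

Lemma dotDr n (u v w : 'cV[R]_n) : dot u (v + w) = dot u v + dot u w.
Proof. by rewrite -big_split; apply: eq_bigr => i _; rewrite mxE mulrDr. Qed.

Lemma dotDl n (u v w : 'cV[R]_n) : dot (v + w) u = dot v u + dot w u.
Proof. by rewrite dotC dotDr !(dotC u). Qed.

Lemma dotZr n (u v : 'cV[R]_n) k : dot u (k *: v) = k * dot u v.
Proof. by rewrite mulr_sumr; apply: eq_bigr => i _; rewrite mxE mulrCA. Qed.

Lemma dotZl n (u v : 'cV[R]_n) k : dot (k *: u) v = k * dot u v.
Proof. by rewrite dotC dotZr dotC. Qed.

Lemma dotNr n (u v : 'cV[R]_n) : dot u (- v) = - dot u v.
Proof. by rewrite -scaleN1r dotZr mulN1r. Qed.

Lemma dotNl n (u v : 'cV[R]_n) : dot (- u) v = - dot u v.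
Proof. by rewrite dotC dotNr dotC. Qed.

Lemma dot0r n (u : 'cV[R]_n) : dot u 0 = 0.
Proof. by rewrite -(scale0r 0) dotZr mul0r. Qed.

Lemma dotE n (u v : 'cV[R]_n) : (u^T *m v) 0 0 = dot u v.
Proof. by rewrite mxE; apply: eq_bigr => i _; rewrite mxE. Qed.

Lemma sqnorm2E n (v : 'cV[R]_n) : sqnorm2 v = dot v v.
Proof. by apply: eq_bigr => i _; rewrite expr2. Qed.

Lemma quadE n (M : 'M[R]_n) (x : 'cV[R]_n) : quad M x = dot x (M *m x).
Proof. by rewrite /quad -mulmxA dotE. Qed.

Lemma dot_mulmxl m n (A : 'M[R]_(m, n)) x y :
  dot (A *m x) y = dot x (A^T *m y).
Proof. by rewrite -!dotE trmx_mul mulmxA. Qed.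

Lemma dot_mulmxr m n (A : 'M[R]_(m, n)) x y :
  dot x (A *m y) = dot (A^T *m x) y.
Proof. by rewrite dot_mulmxl trmxK. Qed.

Lemma sqnorm2_ge0 n (v : 'cV[R]_n) : 0 <= sqnorm2 v.
Proof. by apply: sumr_ge0 => i _; exact: sqr_ge0. Qed.

Lemma sqnorm2_eq0 n (v : 'cV[R]_n) : sqnorm2 v = 0 -> v = 0.
Proof.
move=> v0; apply/colP => i; rewrite mxE; apply/eqP; rewrite -sqrf_eq0.
have /eqP := v0; rewrite psumr_eq0 => [/allP/(_ i)|j _]; last exact: sqr_ge0.
by apply; rewrite mem_index_enum.
Qed.

Lemma sqnorm2Z n k (v : 'cV[R]_n) : sqnorm2 (k *: v) = k ^+ 2 * sqnorm2 v.
Proof. by rewrite !sqnorm2E dotZl dotZr mulrA expr2. Qed.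

Lemma sqnorm20 n : sqnorm2 (0 : 'cV[R]_n) = 0.
Proof. by rewrite sqnorm2E dot0r. Qed.

Lemma sqnorm2D n (u v : 'cV[R]_n) :
  sqnorm2 (u + v) = sqnorm2 u + 2 * dot u v + sqnorm2 v.
Proof. by rewrite !sqnorm2E !(dotDl, dotDr) (dotC v u); ring. Qed.

Lemma sqnorm2N n (v : 'cV[R]_n) : sqnorm2 (- v) = sqnorm2 v.
Proof. by rewrite -scaleN1r sqnorm2Z sqrrN expr1n mul1r. Qed.

Lemma sqnorm2B n (u v : 'cV[R]_n) :
  sqnorm2 (u - v) = sqnorm2 u - 2 * dot u v + sqnorm2 v.
Proof. by rewrite sqnorm2D sqnorm2N dotNr mulrN. Qed.

(** Discriminant argument: for [a > 0] evaluate at the minimizer [- b / a]; for [a = 0] and [b != 0]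
    the affine function takes the value -1 at [- (c + 1) / (2 * b)]. *)
Lemma sqr_le_of_quadratic_ge0 (a b c : R) : 0 <= a ->
  (forall s, 0 <= s ^+ 2 * a + 2 * s * b + c) -> b ^+ 2 <= a * c.
Proof.
move=> a0 q; have [aE|an0] := eqVneq a 0.
  rewrite aE mul0r; have [-> |bn0] := eqVneq b 0; first by rewrite expr0n.
  have E : 2 * (- (c + 1) / (2 * b)) * b = - (c + 1) by field.
  by have := q (- (c + 1) / (2 * b)); rewrite aE mulr0 add0r E; lra.
have E : (- b / a) ^+ 2 * a + 2 * (- b / a) * b + c = (a * c - b ^+ 2) / a.
  by field.
have := q (- b / a); rewrite E.
by rewrite pmulr_lge0 ?subr_ge0// invr_gt0 lt_neqAle eq_sym an0.
Qed.

Lemma psdmx_cauchy n (M : 'M[R]_n) (x y : 'cV[R]_n) : psdmx M ->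
  dot x (M *m y) ^+ 2 <= quad M x * quad M y.
Proof.
move=> [Msym Mge0]; apply: sqr_le_of_quadratic_ge0 => // s.
have := Mge0 (s *: x + y); rewrite !quadE mulmxDr -scalemxAr.
rewrite !(dotDl, dotDr, dotZl, dotZr) [dot y (M *m x)]dot_mulmxr Msym.
by rewrite [dot (M *m y) x]dotC; congr (_ <= _); ring.
Qed.

Lemma psdmx1 n : psdmx (1%:M : 'M[R]_n).
Proof.
split=> [|x]; first by rewrite trmx1.
by rewrite quadE mul1mx -sqnorm2E sqnorm2_ge0.
Qed.

Lemma cauchy_schwarz n (u v : 'cV[R]_n) :
  dot u v ^+ 2 <= sqnorm2 u * sqnorm2 v.
Proof.
by have := psdmx_cauchy u v (psdmx1 n); rewrite !quadE !mul1mx -!sqnorm2E.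
Qed.

Definition frob m n (M : 'M[R]_(m, n)) : R := \sum_i \sum_j M i j ^+ 2.

Lemma frob_ge0 m n (M : 'M[R]_(m, n)) : 0 <= frob M.
Proof. by apply: sumr_ge0 => i _; apply: sumr_ge0 => j _; exact: sqr_ge0. Qed.

Lemma frob_tr m n (M : 'M[R]_(m, n)) : frob M^T = frob M.
Proof.
rewrite /frob exchange_big; apply: eq_bigr => i _; apply: eq_bigr => j _.
by rewrite mxE.
Qed.

Lemma trace_mul_tr m n (M : 'M[R]_(m, n)) : \tr (M *m M^T) = frob M.
Proof.
apply: eq_bigr => i _; rewrite mxE; apply: eq_bigr => j _.
by rewrite mxE expr2.
Qed.

Lemma trace_tr_mul m n (M : 'M[R]_(m, n)) : \tr (M^T *m M) = frob M.
Proof. by rewrite mxtrace_mulC trace_mul_tr. Qed.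

Lemma frobZ m n k (M : 'M[R]_(m, n)) : frob (k *: M) = k ^+ 2 * frob M.
Proof.
rewrite mulr_sumr; apply: eq_bigr => i _; rewrite mulr_sumr.
by apply: eq_bigr => j _; rewrite mxE exprMn.
Qed.

Lemma frob_eq0 m n (M : 'M[R]_(m, n)) : frob M = 0 -> M = 0.
Proof.
move=> M0; apply/matrixP => i j; rewrite mxE; apply/eqP; rewrite -sqrf_eq0.
move/eqP: M0; rewrite psumr_eq0 => [/allP/(_ i)|k _]; last first.
  by apply: sumr_ge0 => l _; exact: sqr_ge0.
rewrite mem_index_enum => /(_ isT); rewrite psumr_eq0 => [/allP/(_ j)|k _].
  by rewrite mem_index_enum; exact.
exact: sqr_ge0.
Qed.

Lemma frob_row m n (M : 'M[R]_(m, n)) :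
  frob M = \sum_i sqnorm2 (row i M)^T.
Proof.
by apply: eq_bigr => i _; apply: eq_bigr => j _; rewrite !mxE.
Qed.

Lemma mulmx_row_dot m n (M : 'M[R]_(m, n)) x i :
  (M *m x) i 0 = dot (row i M)^T x.
Proof. by rewrite mxE; apply: eq_bigr => j _; rewrite !mxE. Qed.

Lemma sqnorm2_mulmx m n (M : 'M[R]_(m, n)) x :
  sqnorm2 (M *m x) <= frob M * sqnorm2 x.
Proof.
rewrite frob_row mulr_suml; apply: ler_sum => i _.
by rewrite mulmx_row_dot cauchy_schwarz.
Qed.

Lemma frob_col m n (M : 'M[R]_(m, n)) : frob M = \sum_j sqnorm2 (col j M).
Proof.
rewrite -frob_tr frob_row; apply: eq_bigr => j _.
by rewrite -tr_col trmxK.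
Qed.

Lemma frob_mulmx m n p (M : 'M[R]_(m, n)) (N : 'M[R]_(n, p)) :
  frob (M *m N) <= frob M * frob N.
Proof.
rewrite !(frob_col (M *m N)) (frob_col N) mulr_sumr; apply: ler_sum => j _.
by rewrite colE -mulmxA -colE sqnorm2_mulmx.
Qed.

Lemma quad_block m n (A : 'M[R]_m) (B : 'M[R]_(m, n)) (C : 'M[R]_(n, m))
    (D : 'M[R]_n) (x : 'cV[R]_m) (y : 'cV[R]_n) :
  quad (block_mx A B C D) (col_mx x y) =
  quad A x + dot x (B *m y) + dot y (C *m x) + quad D y.
Proof.
rewrite /quad tr_col_mx mul_row_block mul_row_col !mulmxDl.
have D00 (P Q : 'M[R]_1) : (P + Q) 0 0 = P 0 0 + Q 0 0 by rewrite mxE.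
by rewrite !D00 -!mulmxA !dotE; ring.
Qed.

Lemma dot_delta n (v : 'cV[R]_n) i : dot (delta_mx i 0) v = v i 0.
Proof.
rewrite /dot (bigD1 i)//= big1 ?addr0 ?mxE ?eqxx ?mul1r// => j ji.
by rewrite mxE (negbTE ji) mul0r.
Qed.

Lemma psdmx_diag_ge0 n (M : 'M[R]_n) i : psdmx M -> 0 <= M i i.
Proof.
by move=> [_ /(_ (delta_mx i 0))]; rewrite quadE dot_delta -colE mxE.
Qed.

(* Cholesky factorization: the Schur complement of the first diagonal entry is
   positive semidefinite, also when that entry is [0] since then the whole first
   row vanishes. *)
Lemma psdmx_factor n (M : 'M[R]_n) : psdmx M -> exists G : 'M[R]_n, M = G^T *m G.
Proof.
elim: n M => [|n IH] M psdM; first by exists 0; apply/matrixP => -[].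
have [Msym Mge0] := psdM.
change ('M[R]_(1 + n)) in M.
set a := M 0 0.
have a0 : 0 <= a by exact: psdmx_diag_ge0.
set b : 'rV_n := ursubmx M.
set C := drsubmx M.
have aM : ulsubmx M = a%:M.
  by apply/matrixP => i j; rewrite !ord1 !mxE/= mulr1n; congr (M _ _);
    apply: val_inj.
have bM : dlsubmx M = b^T by rewrite /b trmx_ursub Msym.
have CM : C^T = C by rewrite /C trmx_drsub Msym.
have ME : M = block_mx a%:M b b^T C by rewrite -aM -bM submxK.
have b0 : a = 0 -> b = 0.
  move=> aE0; apply/rowP => j; rewrite [RHS]mxE; apply/eqP; rewrite -sqrf_eq0.
  have := psdmx_cauchy (delta_mx 0 0) (delta_mx (rshift 1 j) 0) psdM.
  rewrite quadE !dot_delta -!colE !mxE -/a aE0 mul0r => bj.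
  rewrite eq_le sqr_ge0 andbT; move: bj; congr (M _ _ ^+ 2 <= 0).
  exact: val_inj.
have sqa : (Num.sqrt a) ^+ 2 = a by rewrite sqr_sqrtr.
(* Division by zero yields 0, harmlessly here since [a = 0] forces [b = 0]; the factor below thus
   needs no case distinction. *)
have sb : (Num.sqrt a / Num.sqrt a) *: b = b.
  have [aE0|an0] := eqVneq a 0; first by rewrite b0// scaler0.
  by rewrite divff ?scale1r// sqrtr_eq0 -ltNge lt_neqAle eq_sym an0.
have [|G GE] := IH (C - a^-1 *: (b^T *m b)).
  split; first by rewrite !linearB/= linearZ/= trmx_mul trmxK CM.
  have QE (x : 'cV_1) (y : 'cV_n) : quad M (col_mx x y) =
      quad a%:M x + dot x (b *m y) + dot y (b^T *m x) + quad C y.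
    by rewrite {1}ME; exact: quad_block.
  (* For fixed [y] this first coordinate minimizes the form of [M], and what remains is the Schur
     complement; for [a = 0] it is 0. *)
  move=> y; have := Mge0 (col_mx (- a^-1 *: (b *m y)) y).
  rewrite QE !quadE.
  set q := dot (b *m y) (b *m y).
  have -> : dot y ((C - a^-1 *: (b^T *m b)) *m y) = dot y (C *m y) - a^-1 * q.
    rewrite mulmxBl dotDr dotNr -scalemxAl dotZr -mulmxA.
    by rewrite [dot y (b^T *m _)]dot_mulmxr trmxK.
  rewrite mul_scalar_mx [dot y (b^T *m _)]dot_mulmxr trmxK !(dotZl, dotZr) -/q.
  have [aE0|an0] := eqVneq a 0.
    by rewrite aE0 invr0 !(mul0r, oppr0, mulr0, add0r, subr0).
  by congr (_ <= _); field.
pose G' : 'M[R]_(1 + n) := block_mx (Num.sqrt a)%:M ((Num.sqrt a)^-1 *: b) 0 G.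
suff E : G'^T *m G' = block_mx a%:M b b^T C by exists G'; rewrite {1}ME -E.
rewrite tr_block_mx mulmx_block tr_scalar_mx trmx0 !mul0mx !mulmx0 !addr0.
rewrite -scalar_mxM -expr2 sqa mul_scalar_mx scalerA sb -GE.
congr block_mx.
  by rewrite linearZ/= mul_mx_scalar scalerA -[RHS](congr1 trmx sb) linearZ.
rewrite [(_ *: b)^T]linearZ/= -scalemxAl -scalemxAr scalerA -invfM -expr2 sqa.
by rewrite addrC subrK.
Qed.

Lemma pdmx_unit n (M : 'M[R]_n) :
  (forall x, x != 0 -> 0 < quad M x) -> M \in unitmx.
Proof.
move=> Mpd; rewrite -row_free_unit -kermx_eq0; apply/rowV0P => v /sub_kermxP vM.
apply/eqP/contraT => vn0.
have : v^T != 0 by rewrite -trmx0 (inj_eq trmx_inj).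
by move=> /Mpd; rewrite /quad trmxK vM mul0mx mxE ltxx.
Qed.

End euclidean.

(** * A minimax theorem for strongly convex functions; ellitopes *)

Section minimax.
Context {R : realType}.

(* If [z0] nearly maximizes the concave function [z |-> L (sol z) z], moving
   slightly from [z0] towards [z] displaces the minimizer by little, because of
   strong convexity; hence [L (sol z0) z] cannot exceed the maximum by much. *)
Lemma strongly_convex_minimax (Y Z : Type) (D : set Z) (mix : R -> Z -> Z -> Z)
    (L : Y -> Z -> R) (dd : Y -> Y -> R) (sol : Z -> Y) (C g0 delta : R) :
  D !=set0 ->
  (forall s z z', 0 < s < 1 -> D z -> D z' -> D (mix s z z')) ->
  (forall s y z z', 0 < s < 1 -> D z -> D z' ->
    L y (mix s z z') = (1 - s) * L y z + s * L y z') ->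
  (forall y y', 0 <= dd y y') ->
  (forall z z', D z -> D z' ->
    L (sol z) z + dd (sol z') (sol z) <= L (sol z') z) ->
  0 <= C ->
  (forall k z z' z0, 0 < k -> D z -> D z' -> D z0 ->
    L (sol z0) z <= L (sol z') z + C / k + k * dd (sol z') (sol z0)) ->
  (forall z, D z -> L (sol z) z <= g0) -> 0 < delta ->
  exists2 z0, D z0 & forall z, D z -> L (sol z0) z <= g0 + delta.
Proof.
move=> [zD Dz] Dmix Lmix dd0 strong C0 lip Lg0 del0.
pose g := [set L (sol z) z | z in D].
have g_sup : has_sup g.
  by split; [exists (L (sol zD) zD); exists zD|
    exists g0 => _ [z Dz' <-]; exact: Lg0].
have Gg0 : sup g <= g0.
  by apply: ge_sup => [|_ [z Dz' <-]]; [exact: g_sup.1|exact: Lg0].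
(* Step length: [s <= 1 / 2] keeps at least half of the weight on [z0], and [2 * s * C <= delta / 2]
   controls the Lipschitz error. *)
pose s := Num.min (1 / 2) (delta / (4 * (C + 1))).
have s0 : 0 < s.
  by rewrite lt_min; apply/andP; split; [lra|apply: divr_gt0 => //; lra].
have s12 : s <= 1 / 2 by rewrite ge_min lexx.
have sC : 2 * s * C <= delta / 2.
  have : s <= delta / (4 * (C + 1)) by rewrite ge_min lexx orbT.
  rewrite ler_pdivlMr; last by lra.
  by have : 0 <= s * C by [rewrite mulr_ge0// ltW]; lra.
(* A move of length [s] changes the value only by order [s], so [z0] has to be optimal up to a
   multiple of [s * delta]. *)
have [|_ [z0 Dz0 <-] gz0] := @sup_adherent _ g (s * delta / 2) _ g_sup.
  by rewrite divr_gt0// mulr_gt0.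
exists z0 => // z Dz'.
have s01 : 0 < s < 1 by apply/andP; split; lra.
have Dzs := Dmix s z0 z s01 Dz0 Dz'.
set zs := mix s z0 z in Dzs.
have Lsup : L (sol zs) zs <= sup g by apply: ub_le_sup; [exact: g_sup.2|exists zs].
rewrite Lmix// in Lsup.
have st := strong z0 zs Dz0 Dzs.
(* With [k = 1 / (2 * s)] the displacement costs [d / 2] after weighting by [s], and the strong
   convexity term [(1 - s) * d] pays for it. *)
have k0 : 0 < (2 * s)^-1 by rewrite invr_gt0; lra.
have lp := lip _ z zs z0 k0 Dz' Dzs Dz0.
rewrite invrK in lp.
set d := dd _ _ in st lp; have d0 : 0 <= d by exact: dd0.
have st' : (1 - s) * (L (sol z0) z0 + d) <= (1 - s) * L (sol zs) z0.
  by rewrite ler_wpM2l//; lra.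
have lp' : s * L (sol z0) z <= s * L (sol zs) z + s * (C * (2 * s)) + d / 2.
  have -> : d / 2 = s * ((2 * s)^-1 * d) by field; lra.
  by rewrite -!mulrDr ler_wpM2l// ltW.
have sd : s * d <= d / 2.
  by rewrite mulrC ler_wpM2l//; lra.
have g1 : (1 - s) * (sup g - s * delta / 2) <= (1 - s) * L (sol z0) z0.
  by rewrite ler_wpM2l//; [lra|exact: ltW].
have sC' : s * (2 * s * C) <= s * (delta / 2) by rewrite ler_wpM2l// ltW.
rewrite -(ler_pM2l s0).
have : s * sup g <= s * g0 by rewrite ler_wpM2l// ltW.
have : 0 <= s * (s * delta / 2) by rewrite !mulr_ge0// ?ltW//; lra.
lra.
Qed.

End minimax.

Section ellitope_facts.
Context {R : realType} {n K : nat}.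
Variables (S_ : 'I_K -> 'M[R]_n) (T : set 'cV[R]_K).
Hypothesis eT : ellitope_data S_ T.

Lemma ellitope_pos : exists2 t0 : 'cV[R]_K, T t0 &
  exists2 c : R, 0 < c & forall k, c <= t0 k 0.
Proof.
have [t0 [Tt0 /nbhs_ballP[e /= e0 et0]]] := ell_interior eT.
exists t0 => //; exists (e / 2); first by rewrite divr_gt0.
move=> k; have : nneg_cV (t0 - const_mx (e / 2)).
  apply: et0; split => // i j; rewrite !mxE /ball/=.
  by rewrite (_ : _ - _ = e / 2) ?gtr0_norm; lra.
by move=> /(_ k); rewrite !mxE subr_ge0.
Qed.

Lemma ellitope_bounded : exists2 b : R, 0 <= b &
  forall t k, T t -> t k 0 <= b.
Proof.
have [M [_ MT]] := compact_bounded (ell_compact eT).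
exists (Num.max 0 (M + 1)); first by rewrite le_max lexx.
move=> t k Tt; rewrite le_max; apply/orP; right.
have /MT/(_ _ Tt) : M < M + 1 by rewrite ltrDl.
apply: le_trans; apply: le_trans (ler_norm _) _.
rewrite [leRHS]/Num.norm/= mx_normrE; apply/bigmax_geP; right => /=.
by exists (k, 0).
Qed.

Lemma ellitope_mix (s : R) t t' : 0 <= s <= 1 -> T t -> T t' ->
  T ((1 - s) *: t + s *: t').
Proof.
move=> /andP[s0 s1] Tt Tt'.
have p0 : 0 <= 1 - s by lra.
have p1 : 1 - s <= 1 by lra.
have : T ((1 - s) *: t + (1 - (1 - s)) *: t').
  exact: set_mem (ell_convex eT (Itv01 p0 p1) (mem_set Tt) (mem_set Tt')).
by rewrite subKr.
Qed.

Lemma ellitope0 : T 0.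
Proof.
have [t Tt] := ell_nonempty eT.
apply: (ell_monotone eT Tt) => k; rewrite mxE lexx/=.
exact: (ell_nneg eT Tt).
Qed.

(** [\sum_k S_ k] factors as [G^T *m G] with [G] invertible. This bounds the traces in [ellQ] and
    lets a multiple of [sqnorm2] be paid for by raising all multipliers. *)
Lemma sqnorm2_le_sum_quad : exists2 c : R, 0 <= c &
  forall x, sqnorm2 x <= c * \sum_k quad (S_ k) x.
Proof.
have [Msym Mpd] := ell_sum_pd eT.
set M := \sum_k S_ k in Msym Mpd.
have quad_sum x : \sum_k quad (S_ k) x = quad M x.
  by rewrite /quad /M mulmx_sumr mulmx_suml summxE.
have [|G GE] := @psdmx_factor R n M.
  split => // x; have [->|/Mpd/ltW//] := eqVneq x 0.
  by rewrite quadE dotC dot0r.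
have quadG x : quad M x = sqnorm2 (G *m x).
  by rewrite quadE GE -mulmxA dot_mulmxr trmxK sqnorm2E.
have Gu : G \in unitmx.
  have Mu := pdmx_unit Mpd.
  by move: Mu; rewrite GE unitmx_mul => /andP[].
exists (frob (invmx G)); first exact: frob_ge0.
move=> x; rewrite quad_sum quadG -{1}[x](mulKmx Gu).
exact: sqnorm2_mulmx.
Qed.

(** [sup] is an upper bound only when the set is bounded above, which the bound on the coordinates
    of [T] ensures. *)
Lemma phi_ub (lambda t : 'cV[R]_K) : (forall k, 0 <= lambda k 0) ->
  T t -> dot lambda t <= phi T lambda.
Proof.
move=> l0 Tt; rewrite -dotE; apply: ub_le_sup; last by exists t.
have [b b0 bT] := ellitope_bounded.
exists (\sum_k lambda k 0 * b) => _ [t' Tt' <-]; rewrite dotE.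
by apply: ler_sum => k _; rewrite ler_wpM2l// bT.
Qed.

Lemma phi_le (lambda : 'cV[R]_K) c :
  (forall t, T t -> dot lambda t <= c) -> phi T lambda <= c.
Proof.
move=> lc; apply: ge_sup.
  by have [t Tt] := ell_nonempty eT; exists ((lambda^T *m t) 0 0); exists t.
by move=> _ [t Tt <-]; rewrite dotE lc.
Qed.

End ellitope_facts.

(** * Linear estimates under a random signal *)

Section matrix_inner_product.
Context {R : realType}.

Definition mxdot m n (X Y : 'M[R]_(m, n)) : R := \sum_i \sum_j X i j * Y i j.

Lemma mxdotE m n (X Y : 'M[R]_(m, n)) : mxdot X Y = \tr (X *m Y^T).
Proof.
by apply: eq_bigr => i _; rewrite mxE; apply: eq_bigr => j _; rewrite mxE.
Qed.

Lemma mxdot_tr m n (X Y : 'M[R]_(m, n)) : mxdot X Y = \tr (X^T *m Y).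
Proof. by rewrite mxdotE mxtrace_mulC -mxtrace_tr trmx_mul trmxK. Qed.

Lemma frobD m n (X Y : 'M[R]_(m, n)) :
  frob (X + Y) = frob X + 2 * mxdot X Y + frob Y.
Proof.
rewrite /frob /mxdot mulr_sumr -!big_split; apply: eq_bigr => i _.
rewrite mulr_sumr -!big_split; apply: eq_bigr => j _.
by rewrite mxE /=; ring.
Qed.

Lemma frobN m n (X : 'M[R]_(m, n)) : frob (- X) = frob X.
Proof. by rewrite -scaleN1r frobZ sqrrN expr1n mul1r. Qed.

Lemma mxdotNr m n (X Y : 'M[R]_(m, n)) : mxdot X (- Y) = - mxdot X Y.
Proof.
rewrite -sumrN; apply: eq_bigr => i _; rewrite -sumrN; apply: eq_bigr => j _.
by rewrite mxE mulrN.
Qed.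

Lemma mxdot0r m n (X : 'M[R]_(m, n)) : mxdot X 0 = 0.
Proof. by apply: big1 => i _; apply: big1 => j _; rewrite mxE mulr0. Qed.

Lemma frobB m n (X Y : 'M[R]_(m, n)) :
  frob (X - Y) = frob X - 2 * mxdot X Y + frob Y.
Proof. by rewrite frobD frobN mxdotNr mulrN. Qed.

(** Young's inequality, entry by entry. *)
Lemma mxdot_le m n (X Y : 'M[R]_(m, n)) k : 0 < k ->
  2 * mxdot X Y <= k * frob X + frob Y / k.
Proof.
move=> k0; rewrite /mxdot /frob !mulr_sumr mulr_suml -big_split.
apply: ler_sum => i _; rewrite !mulr_sumr mulr_suml -big_split.
apply: ler_sum => j _ /=; rewrite -subr_ge0.
have -> : k * X i j ^+ 2 + Y i j ^+ 2 / k - 2 * (X i j * Y i j) =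
    (k * X i j - Y i j) ^+ 2 / k by field; lra.
by rewrite divr_ge0 ?sqr_ge0// ltW.
Qed.

Lemma frobD_le m n (X Y : 'M[R]_(m, n)) :
  frob (X + Y) <= 2 * frob X + 2 * frob Y.
Proof.
by rewrite frobD; have := mxdot_le X Y ltr01; rewrite mul1r divr1; lra.
Qed.

Lemma trace_factor m n (X : 'M[R]_(m, n)) (G : 'M[R]_n) :
  \tr (X *m (G^T *m G) *m X^T) = frob (X *m G^T).
Proof. by rewrite -trace_mul_tr trmx_mul trmxK !mulmxA. Qed.

Lemma psdmx_trace_ge0 m n (X : 'M[R]_(m, n)) (Q : 'M[R]_n) : psdmx Q ->
  0 <= \tr (X *m Q *m X^T).
Proof. by move=> /psdmx_factor[G ->]; rewrite trace_factor frob_ge0. Qed.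

Lemma psdmx_trace_mul_ge0 n (Q P : 'M[R]_n) : psdmx Q -> psdmx P ->
  0 <= \tr (Q *m P).
Proof.
move=> psdQ /psdmx_factor[G ->].
by rewrite mulmxA mxtrace_mulC mulmxA psdmx_trace_ge0.
Qed.

Lemma psdmx_trace_le m n (X : 'M[R]_(m, n)) (Q : 'M[R]_n) : psdmx Q ->
  \tr (X *m Q *m X^T) <= frob X * \tr Q.
Proof.
move=> /psdmx_factor[G ->]; rewrite trace_factor trace_tr_mul.
by rewrite (le_trans (frob_mulmx _ _))// frob_tr.
Qed.

Lemma frob_psdmx_le n (Q : 'M[R]_n) : psdmx Q -> frob Q <= (\tr Q) ^+ 2.
Proof.
move=> /psdmx_factor[G ->]; rewrite trace_tr_mul expr2.
by rewrite (le_trans (frob_mulmx _ _))// frob_tr.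
Qed.

Lemma psdmxZ n (k : R) (Q : 'M[R]_n) : 0 <= k -> psdmx Q -> psdmx (k *: Q).
Proof.
move=> k0 [Qs Q0]; split; first by rewrite linearZ/= Qs.
by move=> x; rewrite quadE -scalemxAl dotZr -quadE mulr_ge0.
Qed.

Lemma psdmxD n (P Q : 'M[R]_n) : psdmx P -> psdmx Q -> psdmx (P + Q).
Proof.
move=> [Ps P0] [Qs Q0]; split; first by rewrite linearD/= Ps Qs.
by move=> x; rewrite quadE mulmxDl dotDr -!quadE addr_ge0.
Qed.

Lemma psdmx0 n : psdmx (0 : 'M[R]_n).
Proof. by have := psdmxZ (lexx 0) (psdmx1 n); rewrite scale0r. Qed.

Lemma quad_rank1 n (P : 'M[R]_n) (x : 'cV[R]_n) :
  \tr (x *m x^T *m P) = quad P x.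
Proof. by rewrite -mulmxA mxtrace_mulC /quad /mxtrace big_ord1. Qed.

Lemma psdmx_rank1 n (x : 'cV[R]_n) : psdmx (x *m x^T).
Proof.
split; first by rewrite trmx_mul trmxK.
move=> y; rewrite quadE -mulmxA.
rewrite (_ : x^T *m y = (dot x y)%:M); last first.
  by rewrite [LHS]mx11_scalar dotE.
by rewrite mul_mx_scalar dotZr dotC -expr2 sqr_ge0.
Qed.

End matrix_inner_product.

Section linear_mse.
Context {R : realType} {m n nu : nat}.
Variables (A : 'M[R]_(m, n)) (B : 'M[R]_(nu, n)) (sigma : R).
Hypothesis sigma_gt0 : 0 < sigma.

Definition linear_mse (H : 'M[R]_(m, nu)) (Q : 'M[R]_n) : R :=
  \tr ((B - H^T *m A) *m Q *m (B - H^T *m A)^T) + sigma ^+ 2 * frob H.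

(** Minus one half of the gradient of [linear_mse] in [H]. *)
Definition linear_mse_grad (H : 'M[R]_(m, nu)) (Q : 'M[R]_n) : 'M[R]_(m, nu) :=
  A *m Q *m (B - H^T *m A)^T - sigma ^+ 2 *: H.

(** Of the second-order term of this quadratic function only the noise part is kept, the signal part
    being a squared Frobenius norm; the noise alone provides strong convexity. *)
Lemma linear_mse_expand H H' Q : psdmx Q ->
  linear_mse H Q - 2 * mxdot (H' - H) (linear_mse_grad H Q) +
    sigma ^+ 2 * frob (H' - H) <= linear_mse H' Q.
Proof.
move=> psdQ; set D := H' - H.
have -> : H' = H + D by rewrite addrC subrK.
clearbody D.
have [G QE] := psdmx_factor psdQ.
rewrite /linear_mse /linear_mse_grad QE !trace_factor.
have -> : B - (H + D)^T *m A = (B - H^T *m A) - D^T *m A.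
  by rewrite linearD/= mulmxDl opprD addrA.
set M := B - H^T *m A.
rewrite (mulmxBl M) frobB frobD [mxdot (M *m _) _]mxdotE.
have -> : \tr ((M *m G^T) *m (D^T *m A *m G^T)^T) =
    mxdot D (A *m (G^T *m G) *m M^T).
  by rewrite -mxtrace_tr trmx_mul trmxK mxdot_tr trmx_mul trmxK !mulmxA.
have -> : mxdot D (A *m (G^T *m G) *m M^T - sigma ^+ 2 *: H) =
    mxdot D (A *m (G^T *m G) *m M^T) - sigma ^+ 2 * mxdot H D.
  rewrite [mxdot H D]mxdotE !mxdot_tr mulmxBr linearB/= -scalemxAr linearZ/=.
  by rewrite [\tr (H *m _)]mxtrace_mulC.
by have := frob_ge0 (D^T *m A *m G^T); lra.
Qed.

(** The Wiener filter. The noise variance makes its normal equations solvable even for singular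
    [Q]. *)
Definition best_filter (Q : 'M[R]_n) : 'M[R]_(m, nu) :=
  invmx (A *m Q *m A^T + (sigma ^+ 2)%:M) *m (A *m Q *m B^T).

Lemma best_filter_grad Q : psdmx Q -> linear_mse_grad (best_filter Q) Q = 0.
Proof.
move=> psdQ; rewrite /linear_mse_grad /best_filter.
set N := A *m Q *m A^T + _.
have Nu : N \in unitmx.
  apply: pdmx_unit => x x0; rewrite quadE mulmxDl dotDr mul_scalar_mx dotZr.
  rewrite -sqnorm2E -!mulmxA dot_mulmxr -quadE ltr_wpDl//; first exact: psdQ.2.
  rewrite mulr_gt0 ?exprn_gt0// lt_neqAle sqnorm2_ge0 andbT eq_sym.
  by apply: contra x0 => /eqP /sqnorm2_eq0 ->.
set H := invmx N *m _.
have NH : N *m H = A *m Q *m B^T by rewrite mulKVmx.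
rewrite linearB/= trmx_mul trmxK mulmxBr -NH /N mulmxDl mul_scalar_mx !mulmxA.
by rewrite addrAC addrK subrr.
Qed.

Lemma linear_mse_strong H Q : psdmx Q ->
  linear_mse (best_filter Q) Q + sigma ^+ 2 * frob (H - best_filter Q) <=
  linear_mse H Q.
Proof.
move=> psdQ; have := linear_mse_expand (best_filter Q) H psdQ.
by rewrite best_filter_grad// mxdot0r mulr0 subr0.
Qed.

Lemma linear_mse_mix s H Q Q' :
  linear_mse H ((1 - s) *: Q + s *: Q') =
  (1 - s) * linear_mse H Q + s * linear_mse H Q'.
Proof.
rewrite /linear_mse mulmxDr mulmxDl -!scalemxAr -!scalemxAl linearD/= !linearZ/=.
by ring.
Qed.

(** Compare with the zero filter: the noise term of the optimal filter is below its error, hence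
    below that of the zero filter. *)
Lemma frob_best_filter_le Q : psdmx Q ->
  sigma ^+ 2 * frob (best_filter Q) <= frob B * \tr Q.
Proof.
move=> psdQ; have := linear_mse_strong 0 psdQ.
rewrite sub0r frobN /linear_mse trmx0 mul0mx subr0.
have /eqP -> : frob (0 : 'M[R]_(m, nu)) == 0.
  by rewrite -(scale0r 0) frobZ expr0n mul0r.
have := psdmx_trace_le B psdQ.
have := psdmx_trace_ge0 (B - (best_filter Q)^T *m A) psdQ.
have : 0 <= sigma ^+ 2 * frob (best_filter Q) by rewrite mulr_ge0 ?sqr_ge0 ?frob_ge0.
by rewrite mulr0 addr0; lra.
Qed.

(** The continuity required by [strongly_convex_minimax]: the gradient inequality at
    [best_filter Q0], with the linear term split by Young's inequality. The trace bound controls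
    both the covariance and the filter, hence the gradient. *)
Lemma linear_mse_lipschitz c : exists2 C, 0 <= C & forall k H' Q Q0, 0 < k ->
  psdmx Q -> \tr Q <= c -> psdmx Q0 -> \tr Q0 <= c ->
  linear_mse (best_filter Q0) Q <=
  linear_mse H' Q + C / k + k * (sigma ^+ 2 * frob (H' - best_filter Q0)).
Proof.
(* Bounds [frob (best_filter Q0)]; the [max] is there because the sign of [c] is unknown. *)
pose h := frob B * Num.max 0 c / sigma ^+ 2.
pose C := (2 * (frob A * (c ^+ 2) * (2 * frob B + 2 * (h * frob A))) +
           2 * (sigma ^+ 2 ^+ 2 * h)) / sigma ^+ 2.
have s20 : 0 < sigma ^+ 2 by rewrite exprn_gt0.
have h0 : 0 <= h.
  by rewrite divr_ge0 ?(ltW s20)// mulr_ge0 ?frob_ge0// le_max lexx.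
have C0 : 0 <= C.
  rewrite divr_ge0 ?(ltW s20)// addr_ge0//; last first.
    by rewrite mulr_ge0// mulr_ge0// sqr_ge0.
  rewrite mulr_ge0// mulr_ge0//; first by rewrite mulr_ge0 ?frob_ge0 ?sqr_ge0.
  by apply: addr_ge0; apply: mulr_ge0; rewrite ?frob_ge0// mulr_ge0 ?frob_ge0.
exists C => // k H' Q Q0 k0 psdQ Qc psdQ0 Q0c.
have := linear_mse_expand (best_filter Q0) H' psdQ.
set H := best_filter Q0; set V := linear_mse_grad H Q.
have Hh : frob H <= h.
  rewrite /h ler_pdivlMr// mulrC (le_trans (frob_best_filter_le psdQ0))//.
  by rewrite ler_wpM2l ?frob_ge0// le_max Q0c orbT.
have trQ0 : 0 <= \tr Q.
  by have := psdmx_trace_mul_ge0 psdQ (psdmx1 n); rewrite mulmx1.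
have frobQ : frob Q <= c ^+ 2.
  rewrite (le_trans (frob_psdmx_le psdQ))// lerXn2r// nnegrE//.
  exact: le_trans Qc.
have Vle : frob V / sigma ^+ 2 <= C.
  rewrite ler_wpM2r ?invr_ge0 ?(ltW s20)//.
  rewrite (le_trans (frobD_le _ _))// lerD// ler_wpM2l//; last first.
    by rewrite frobN frobZ ler_wpM2l// sqr_ge0.
  rewrite (le_trans (frob_mulmx _ _))// ler_pM ?frob_ge0//.
    rewrite (le_trans (frob_mulmx _ _))// ler_wpM2l ?frob_ge0//.
  rewrite frob_tr (le_trans (frobD_le _ _))// lerD// frobN ler_wpM2l//.
  rewrite (le_trans (frob_mulmx _ _))// frob_tr ler_wpM2r ?frob_ge0//.
have k1 : 0 < k * sigma ^+ 2 by rewrite mulr_gt0.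
have := mxdot_le (H' - H) V k1.
have : frob V / (k * sigma ^+ 2) <= C / k.
  rewrite invfM mulrA mulrAC ler_wpM2r ?invr_ge0 ?(ltW k0)//.
have : 0 <= sigma ^+ 2 * frob (H' - H) by rewrite mulr_ge0 ?frob_ge0// ltW.
rewrite -[k * sigma ^+ 2 * _]mulrA.
lra.
Qed.

End linear_mse.

(** * Duality for the design problem *)

Section penalized_saddle_point.
Context {R : realType} {m n nu K : nat}.
Variables (S_ : 'I_K -> 'M[R]_n) (T : set 'cV[R]_K).
Variables (A : 'M[R]_(m, n)) (B : 'M[R]_(nu, n)) (sigma : R) (S : 'M[R]_n).
Hypotheses (eT : ellitope_data S_ T) (sigma_gt0 : 0 < sigma) (psdS : psdmx S).

Definition slack (z : 'M[R]_n * 'cV[R]_K) (k : 'I_K) : R :=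
  z.2 k 0 - \tr (z.1 *m S_ k).

(** Minimizing over nonnegative multipliers turns each constraint into the penalty
    [max(0, - slack)^2 / (4 * rho)], which is subtracted; see [penalty_min]. *)
Definition lagrangian (tau rho : R) (y : 'M[R]_(m, nu) * 'cV[R]_K)
    (z : 'M[R]_n * 'cV[R]_K) : R :=
  linear_mse A B sigma y.1 z.1 - tau * (1 + \tr (z.1 *m S)) +
  \sum_k (y.2 k 0 * slack z k + rho * y.2 k 0 ^+ 2).

Definition lagrangian_argmin (rho : R) (z : 'M[R]_n * 'cV[R]_K) :
    'M[R]_(m, nu) * 'cV[R]_K :=
  (best_filter A B sigma z.1, \col_k Num.max 0 (- slack z k / (2 * rho))).

(** The trace bound is artificial: it keeps gradients and slacks bounded, and [optimal_dual] takes
    it large and compensates for it. *)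
Definition saddle_domain (c : R) : set ('M[R]_n * 'cV[R]_K) :=
  [set z | [/\ psdmx z.1, \tr z.1 <= c & T z.2]].

Lemma slack_bounded c : exists2 b, 0 <= b &
  forall z k, saddle_domain c z -> `|slack z k| <= b.
Proof.
have [b b0 bT] := ellitope_bounded eT.
exists (b + (c ^+ 2 + \sum_k frob (S_ k))).
  by rewrite addr_ge0// addr_ge0 ?sqr_ge0// sumr_ge0// => k _; exact: frob_ge0.
move=> [Q t] k [/= psdQ Qc Tt]; rewrite /slack/=.
have t0 : 0 <= t k 0 by exact: (ell_nneg eT Tt).
have tb := bT t k Tt.
have q0 := psdmx_trace_mul_ge0 psdQ (ell_psd eT k).
have [Ssym _] := ell_psd eT k.
have := mxdot_le Q (S_ k) ltr01; rewrite mul1r divr1 mxdotE Ssym.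
have : frob Q <= c ^+ 2.
  rewrite (le_trans (frob_psdmx_le psdQ))// lerXn2r// nnegrE.
    by have := psdmx_trace_mul_ge0 psdQ (psdmx1 n); rewrite mulmx1.
  by apply: le_trans Qc; have := psdmx_trace_mul_ge0 psdQ (psdmx1 n); rewrite mulmx1.
have : frob (S_ k) <= \sum_j frob (S_ j).
  by rewrite (bigD1 k)//= lerDl sumr_ge0// => j _; exact: frob_ge0.
have := sqr_ge0 c; have := frob_ge0 (S_ k).
by move=> *; rewrite ler_norml; apply/andP; split; lra.
Qed.

Lemma saddle_domain_mix c s z z' : 0 < s < 1 ->
  saddle_domain c z -> saddle_domain c z' ->
  saddle_domain c ((1 - s) *: z.1 + s *: z'.1, (1 - s) *: z.2 + s *: z'.2).
Proof.
move=> /andP[s0 s1] [psdz zc Tz] [psdz' zc' Tz']; split => /=.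
- by apply: psdmxD; apply: psdmxZ => //; lra.
- rewrite linearD/= !linearZ/=.
  have : (1 - s) * \tr z.1 <= (1 - s) * c by rewrite ler_wpM2l//; lra.
  have : s * \tr z'.1 <= s * c by rewrite ler_wpM2l//; lra.
  lra.
- by apply: (ellitope_mix eT) => //; apply/andP; split; lra.
Qed.

Lemma lagrangian_mix tau rho s y z z' :
  lagrangian tau rho y
    ((1 - s) *: z.1 + s *: z'.1, (1 - s) *: z.2 + s *: z'.2) =
  (1 - s) * lagrangian tau rho y z + s * lagrangian tau rho y z'.
Proof.
have tr_mix M : \tr (((1 - s) *: z.1 + s *: z'.1) *m M) =
    (1 - s) * \tr (z.1 *m M) + s * \tr (z'.1 *m M).
  by rewrite mulmxDl -!scalemxAl linearD/= !linearZ.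
rewrite /lagrangian/= linear_mse_mix tr_mix.
have -> : \sum_k (y.2 k 0 * slack ((1 - s) *: z.1 + s *: z'.1,
      (1 - s) *: z.2 + s *: z'.2) k + rho * y.2 k 0 ^+ 2) =
    (1 - s) * (\sum_k (y.2 k 0 * slack z k + rho * y.2 k 0 ^+ 2)) +
    s * (\sum_k (y.2 k 0 * slack z' k + rho * y.2 k 0 ^+ 2)).
  rewrite !mulr_sumr -big_split; apply: eq_bigr => k _ /=.
  by rewrite /slack/= tr_mix !mxE; ring.
by ring.
Qed.

Lemma penalty_strong (rho v l : R) : 0 < rho -> 0 <= l ->
  let l0 := Num.max 0 (- v / (2 * rho)) in
  l0 * v + rho * l0 ^+ 2 + rho * (l - l0) ^+ 2 <= l * v + rho * l ^+ 2.
Proof.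
move=> rho0 lp /=; have [v0|v0] := leP 0 v.
  rewrite max_l; last by rewrite pmulr_lle0 ?oppr_le0// invr_gt0; lra.
  have : 0 <= l * v by rewrite mulr_ge0.
  by rewrite !expr2; lra.
rewrite max_r; last by rewrite divr_ge0//; lra.
by rewrite le_eqVlt; apply/orP; left; apply/eqP; field; lra.
Qed.

Lemma penalty_min (rho v : R) : 0 < rho ->
  let l0 := Num.max 0 (- v / (2 * rho)) in
  l0 * v + rho * l0 ^+ 2 = - (Num.max 0 (- v)) ^+ 2 / (4 * rho).
Proof.
move=> rho0 /=; have [v0|v0] := leP 0 v.
  rewrite max_l; last by rewrite pmulr_lle0 ?oppr_le0// invr_gt0; lra.
  by rewrite max_l ?oppr_le0// !expr2; field; lra.
rewrite max_r; last by rewrite divr_ge0//; lra.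
by rewrite max_r ?oppr_ge0 1?ltW//; field; lra.
Qed.

(** In its use [l0] is the minimizer for another slack than [v]. The number [w] is the derivative at
    [l0], and its linear term is split by completing a square. *)
Lemma penalty_lipschitz (rho v l0 l k b : R) : 0 < rho -> 0 < k ->
  `|v + 2 * rho * l0| <= b ->
  l0 * v + rho * l0 ^+ 2 <=
  l * v + rho * l ^+ 2 + b ^+ 2 / rho / k + k * (rho * (l - l0) ^+ 2).
Proof.
move=> rho0 k0 vb; set w := v + 2 * rho * l0 in vb.
have w2 : w ^+ 2 <= b ^+ 2.
  by rewrite -real_normK ?num_real// lerXn2r// nnegrE// (le_trans _ vb).
have wb : w ^+ 2 / rho / k <= b ^+ 2 / rho / k.
  by rewrite ler_pM2r ?invr_gt0// ler_pM2r ?invr_gt0.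
have d0 : 0 <= rho * (l - l0) ^+ 2 by rewrite mulr_ge0 ?sqr_ge0 ?ltW.
have kr0 : 0 < k * rho by rewrite mulr_gt0.
have : 0 <= (2 * k * rho * (l - l0) + w) ^+ 2 / (4 * (k * rho)).
  by rewrite divr_ge0 ?sqr_ge0//; lra.
have -> : (2 * k * rho * (l - l0) + w) ^+ 2 / (4 * (k * rho)) =
    k * (rho * (l - l0) ^+ 2) + (l - l0) * w + w ^+ 2 / rho / k / 4.
  by field; apply/andP; split; lra.
have : 0 <= w ^+ 2 / rho / k by rewrite !divr_ge0 ?sqr_ge0// ltW.
have -> : l0 * v + rho * l0 ^+ 2 =
    l * v + rho * l ^+ 2 - (l - l0) * w - rho * (l - l0) ^+ 2.
  by rewrite /w; ring.
lra.
Qed.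

(** Weighted by the moduli of strong convexity, so that [lagrangian_strong] holds with constant
    one. *)
Definition argmin_dist rho (y y' : 'M[R]_(m, nu) * 'cV[R]_K) : R :=
  sigma ^+ 2 * frob (y.1 - y'.1) + \sum_k rho * (y.2 k 0 - y'.2 k 0) ^+ 2.

Lemma argmin_dist_ge0 rho y y' : 0 < rho -> 0 <= argmin_dist rho y y'.
Proof.
move=> rho0; rewrite addr_ge0//; first by rewrite mulr_ge0 ?frob_ge0 ?sqr_ge0.
by apply: sumr_ge0 => k _; rewrite mulr_ge0 ?sqr_ge0 ?ltW.
Qed.

Lemma lagrangian_strong tau rho (y : 'M[R]_(m, nu) * 'cV[R]_K) z : 0 < rho -> psdmx z.1 ->
  (forall k, 0 <= y.2 k 0) ->
  lagrangian tau rho (lagrangian_argmin rho z) z +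
    argmin_dist rho y (lagrangian_argmin rho z) <=
  lagrangian tau rho y z.
Proof.
move=> rho0 psdz y0; rewrite /lagrangian /argmin_dist/=.
have := linear_mse_strong A B sigma_gt0 y.1 psdz.
have : \sum_k ((\col_j Num.max 0 (- slack z j / (2 * rho))) k 0 * slack z k +
      rho * (\col_j Num.max 0 (- slack z j / (2 * rho))) k 0 ^+ 2) +
    \sum_k rho * (y.2 k 0 - (\col_j Num.max 0 (- slack z j / (2 * rho))) k 0) ^+ 2
    <= \sum_k (y.2 k 0 * slack z k + rho * y.2 k 0 ^+ 2).
  rewrite -big_split; apply: ler_sum => k _ /=; rewrite mxE.
  exact: penalty_strong.
lra.
Qed.

Lemma lagrangian_lipschitz rho c : 0 < rho -> exists2 C, 0 <= C &
  forall tau k z z' z0, 0 < k -> saddle_domain c z -> saddle_domain c z' ->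
    saddle_domain c z0 ->
  lagrangian tau rho (lagrangian_argmin rho z0) z <=
  lagrangian tau rho (lagrangian_argmin rho z') z + C / k +
  k * argmin_dist rho (lagrangian_argmin rho z') (lagrangian_argmin rho z0).
Proof.
move=> rho0; have [b b0 sb] := slack_bounded c.
have [C C0 CP] := linear_mse_lipschitz A B sigma_gt0 c.
(* [2 * rho * l0] is the positive part of [- slack z0], so the derivative of each penalty is at most
   [b + b] in absolute value. *)
exists (C + \sum_(k < K) (2 * b) ^+ 2 / rho).
  rewrite addr_ge0// sumr_ge0// => k _.
  by rewrite divr_ge0 ?sqr_ge0// ltW.
move=> tau k z z' z0 k0 Dz Dz' Dz0; have [pz zc _] := Dz; have [p0 z0c _] := Dz0.
rewrite /lagrangian /argmin_dist/=.
have := CP k (best_filter A B sigma z'.1) _ _ k0 pz zc p0 z0c.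
set l := \col_j Num.max 0 (- slack z' j / (2 * rho)).
set l0 := \col_j Num.max 0 (- slack z0 j / (2 * rho)).
have : \sum_j (l0 j 0 * slack z j + rho * l0 j 0 ^+ 2) <=
    \sum_j (l j 0 * slack z j + rho * l j 0 ^+ 2) +
    (\sum_(j < K) (2 * b) ^+ 2 / rho) / k +
    k * \sum_j rho * (l j 0 - l0 j 0) ^+ 2.
  rewrite mulr_suml mulr_sumr -!big_split; apply: ler_sum => j _ /=.
  apply: penalty_lipschitz => //; rewrite (le_trans (ler_normD _ _))//.
  have -> : 2 * b = b + b by ring.
  apply: lerD; first exact: sb.
  rewrite mxE.
  have sz0 := sb z0 j Dz0.
  have [v0|v0] := leP 0 (slack z0 j).
    rewrite max_l; last by rewrite pmulr_lle0 ?oppr_le0// invr_gt0; lra.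
    by rewrite mulr0 normr0.
  rewrite max_r; last by rewrite divr_ge0//; lra.
  by rewrite mulrC divfK ?normrN//; lra.
rewrite [k * (_ + _)]mulrDr [(C + _) / k]mulrDl; lra.
Qed.

End penalized_saddle_point.

Section sdp_duality.
Context {R : realType} {m n nu K : nat}.
Variables (S_ : 'I_K -> 'M[R]_n) (T : set 'cV[R]_K).
Variables (A : 'M[R]_(m, n)) (B : 'M[R]_(nu, n)) (sigma : R) (S : 'M[R]_n).
Hypotheses (eT : ellitope_data S_ T) (sigma_gt0 : 0 < sigma) (psdS : psdmx S).

Lemma quad_pencil (lambda : 'cV[R]_K) tau x :
  quad (\sum_k lambda k 0 *: S_ k + tau *: S) x =
  \sum_k lambda k 0 * quad (S_ k) x + tau * quad S x.
Proof.
rewrite quadE mulmxDl dotDr -scalemxAl dotZr -(quadE S); congr (_ + _).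
rewrite mulmx_suml -dotE mulmx_sumr summxE; apply: eq_bigr => k _.
by rewrite -scalemxAl dotE dotZr -quadE.
Qed.

(** Schur complement of the identity block: the form at [(x, y)] is the pencil minus
    [sqnorm2 (D *m x)] plus [sqnorm2 (D *m x + y)], and [y = - (D *m x)] cancels the last square. *)
Lemma psdmx_block_pencil H (lambda : 'cV[R]_K) tau :
  psdmx (block_mx (\sum_k lambda k 0 *: S_ k + tau *: S)
                  (B^T - A^T *m H) (B - H^T *m A) (1%:M : 'M[R]_nu)) <->
  forall x, sqnorm2 ((B - H^T *m A) *m x) <=
    \sum_k lambda k 0 * quad (S_ k) x + tau * quad S x.
Proof.
set P := \sum_k _ + _; set D := B - H^T *m A.
have DT : B^T - A^T *m H = D^T by rewrite linearB/= trmx_mul trmxK.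
have Psym : P^T = P.
  rewrite linearD/= linearZ/= psdS.1; congr (_ + _).
  by rewrite linear_sum; apply: eq_bigr => k _; rewrite linearZ/= (ell_psd eT k).1.
have quadP x y : quad (block_mx P (B^T - A^T *m H) D 1%:M) (col_mx x y) =
    \sum_k lambda k 0 * quad (S_ k) x + tau * quad S x -
    sqnorm2 (D *m x) + sqnorm2 (D *m x + y).
  rewrite quad_block quad_pencil DT dot_mulmxr trmxK sqnorm2D.
  by rewrite (quadE 1%:M) mul1mx -sqnorm2E [dot y _]dotC; ring.
split=> [[_ psdM] x|le].
  have := psdM (col_mx x (- (D *m x))).
  by rewrite quadP subrr sqnorm20 addr0 subr_ge0.
split; first by rewrite tr_block_mx DT trmxK trmx1 Psym.
move=> z; rewrite -[z]vsubmxK quadP addr_ge0 ?sqnorm2_ge0// subr_ge0.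
exact: le.
Qed.

(* A matrix violating the constraints by little enters [ellQ] after a mild
   rescaling, because [t0] is interior. *)
Lemma ellQ_rescale (t0 t : 'cV[R]_K) c Q : T t0 -> 0 < c ->
  (forall k, c <= t0 k 0) -> psdmx Q -> T t ->
  let eta := (\sum_k Num.max 0 (\tr (Q *m S_ k) - t k 0)) / c in
  0 <= eta /\ ellQ S_ T ((1 + eta)^-1 *: Q).
Proof.
move=> Tt0 c0 ct0 psdQ Tt eta.
have u0 k : 0 <= Num.max 0 (\tr (Q *m S_ k) - t k 0) by rewrite le_max lexx.
have eta0 : 0 <= eta by rewrite divr_ge0 ?(ltW c0)// sumr_ge0.
have e1 : 0 < 1 + eta by lra.
split=> //; split; first by apply: psdmxZ => //; rewrite invr_ge0 ltW.
exists ((1 - eta / (1 + eta)) *: t + (eta / (1 + eta)) *: t0).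
  apply: (ellitope_mix eT) => //; rewrite divr_ge0 ?(ltW e1)//=.
  by rewrite ler_pdivrMr//; lra.
move=> k; rewrite -scalemxAl linearZ/= !mxE.
have -> : (1 - eta / (1 + eta)) * t k 0 + eta / (1 + eta) * t0 k 0 =
    (1 + eta)^-1 * (t k 0 + eta * t0 k 0) by field; lra.
rewrite ler_wpM2l ?invr_ge0 ?(ltW e1)// addrC -lerBlDr.
have : Num.max 0 (\tr (Q *m S_ k) - t k 0) <= eta * c.
  rewrite /eta divfK ?gt_eqF// (bigD1 k)//= lerDl.
  by rewrite sumr_ge0.
have : eta * c <= eta * t0 k 0 by rewrite ler_wpM2l.
have : \tr (Q *m S_ k) - t k 0 <= Num.max 0 (\tr (Q *m S_ k) - t k 0).
  by rewrite le_max lexx orbT.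
lra.
Qed.

Lemma linear_mse_scale eta H Q : 0 <= eta ->
  linear_mse A B sigma H Q <=
  (1 + eta) * linear_mse A B sigma H ((1 + eta)^-1 *: Q).
Proof.
move=> eta0; rewrite /linear_mse -scalemxAr -scalemxAl linearZ/= mulrDr mulrA.
rewrite divff ?mul1r; last by lra.
by rewrite lerD2l mulrDl mul1r lerDl !mulr_ge0// ?frob_ge0// ltW.
Qed.

(** Here [rho] does not depend on the trace bound. Rescaling a covariance into [ellQ] costs
    [tau1 * eta], linear in its violations; the quadratic penalty outweighs this up to an error of
    order [rho]. *)
Lemma lagrangian_argmin_lt0 tau1 tau2 :
  0 <= tau1 -> tau1 < tau2 ->
  (forall Q, ellQ S_ T Q ->
    exists H, linear_mse A B sigma H Q < tau1 * (1 + \tr (Q *m S))) ->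
  exists2 rho, 0 < rho & forall c z, saddle_domain T c z ->
    lagrangian S_ A B sigma S tau2 rho (lagrangian_argmin S_ A B sigma rho z) z
    <= - ((tau2 - tau1) / 2).
Proof.
move=> tau10 tau12 Hex.
have [t0 Tt0 [c c0 ct0]] := ellitope_pos eT.
pose del := (tau2 - tau1) / 2.
have del0 : 0 < del by rewrite divr_gt0// subr_gt0.
(* The cost [tau1 / c * u] of a violation [u] exceeds its penalty [u ^+ 2 / (4 * rho)] by at most
   [rho * q]; [rho] is such that [K] of these excesses stay below [del]. *)
pose q := (tau1 / c) ^+ 2.
have q0 : 0 <= q by exact: sqr_ge0.
pose rho := del / ((K%:R + 1) * (q + 1)).
have K0 : 0 <= K%:R :> R by rewrite ler0n.
have rho0 : 0 < rho by rewrite divr_gt0// mulr_gt0//; lra.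
have Krho : K%:R * (rho * q) <= del.
  have -> : K%:R * (rho * q) =
      del * ((K%:R / (K%:R + 1)) * (q / (q + 1))).
    by rewrite /rho; field; apply/andP; split; lra.
  rewrite -[leRHS]mulr1 ler_wpM2l ?(ltW del0)//.
  by rewrite mulr_ile1 ?divr_ge0// ?ler_pdivrMr; lra.
exists rho => // cc [Q t] [/= psdQ _ Tt].
have [] := ellQ_rescale Tt0 c0 ct0 psdQ Tt.
set eta := _ / c => eta0 /Hex[H HQ].
pose l0 : 'cV[R]_K := \col_k Num.max 0 (- slack S_ (Q, t) k / (2 * rho)).
have l00 k : 0 <= l0 k 0 by rewrite mxE le_max lexx.
have := @lagrangian_strong _ _ _ _ _ S_ A B sigma S sigma_gt0 tau2 rho (H, l0)
  (Q, t) rho0 psdQ l00.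
have := argmin_dist_ge0 sigma (H, l0)
  (lagrangian_argmin S_ A B sigma rho (Q, t)) rho0.
set d := argmin_dist _ _ _ _.
set L0 := lagrangian _ _ _ _ _ _ _ _ _.
move=> d0 LH; apply: (@le_trans _ _ (L0 + d)); first by rewrite lerDl.
apply: le_trans LH _; rewrite /lagrangian/=.
have trQS := psdmx_trace_mul_ge0 psdQ psdS.
have f1 : linear_mse A B sigma H Q <= tau1 * (1 + eta + \tr (Q *m S)).
  rewrite (le_trans (linear_mse_scale _ _ eta0))//.
  have e1 : 0 < 1 + eta by lra.
  apply: (@le_trans _ _ ((1 + eta) * (tau1 * (1 + \tr ((1 + eta)^-1 *: Q *m S))))).
    by rewrite ler_pM2l// ltW.
  rewrite -scalemxAl linearZ/= le_eqVlt; apply/orP; left; apply/eqP.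
  by field; lra.
have f2 : \sum_k (l0 k 0 * slack S_ (Q, t) k + rho * l0 k 0 ^+ 2) + tau1 * eta
    <= del.
  have -> : tau1 * eta = \sum_k tau1 / c * Num.max 0 (\tr (Q *m S_ k) - t k 0).
    by rewrite -mulr_sumr /eta; field; lra.
  rewrite -big_split/=; apply: le_trans Krho.
  rewrite mulr_natl -[K in _ *+ K]card_ord -sumr_const; apply: ler_sum => k _.
  rewrite mxE penalty_min// /slack/= opprB /q.
  set u := Num.max _ _; rewrite -subr_ge0.
  have -> : rho * (tau1 / c) ^+ 2 - (- u ^+ 2 / (4 * rho) + tau1 / c * u) =
     (2 * rho * (tau1 / c) - u) ^+ 2 / (4 * rho) by field; apply/andP; split; lra.
  by rewrite divr_ge0 ?sqr_ge0//; lra.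
have : (tau2 - tau1) * 1 <= (tau2 - tau1) * (1 + \tr (Q *m S)).
  by rewrite ler_wpM2l//; lra.
have delE : tau2 - tau1 = 2 * del by rewrite /del; field.
rewrite -/del; lra.
Qed.

(** Otherwise the penalized game has negative value, so some filter and multipliers make the
    Lagrangian nonpositive on the whole domain; after a shift of the multipliers they are feasible
    with objective below [tau]. *)
Lemma optimal_dual tau H lambda tau1 :
  optimal S_ T A B sigma S tau H lambda -> 0 <= tau1 -> tau1 < tau ->
  exists2 Q, ellQ S_ T Q &
    forall H', tau1 * (1 + \tr (Q *m S)) <= linear_mse A B sigma H' Q.
Proof.
move=> [_ opt] tau10 tau1lt; apply: contrapT => noQ.
have Hex Q : ellQ S_ T Q ->
    exists H, linear_mse A B sigma H Q < tau1 * (1 + \tr (Q *m S)).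
  move=> eQ; apply: contrapT => noH; apply: noQ; exists Q => // H'.
  by rewrite leNgt; apply/negP => lt; apply: noH; exists H'.
pose tau2 := (tau1 + tau) / 2.
have tau12 : tau1 < tau2 by rewrite /tau2; lra.
have tau2lt : tau2 < tau by rewrite /tau2; lra.
have [rho rho0 Lneg] := lagrangian_argmin_lt0 tau10 tau12 Hex.
have [b b0 bT] := ellitope_bounded eT.
have [cS cS0 cSP] := sqnorm2_le_sum_quad eT.
(* Large enough that shifting all multipliers by [tau2 * cS / c] raises the objective by less than
   [tau - tau2]. *)
pose c := tau2 * cS * (K%:R * b) / (tau - tau2) + 1.
have c1 : 0 <= tau2 * cS * (K%:R * b) / (tau - tau2).
  by rewrite divr_ge0 ?mulr_ge0//; lra.
have c0 : 0 < c by rewrite /c; lra.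
have [C C0 lip] := lagrangian_lipschitz A B S eT sigma_gt0 c rho0.
have [|||||||||z0 Dz0 Lz0] := @strongly_convex_minimax R _ _
  (saddle_domain T c)
  (fun s z z' => ((1 - s) *: z.1 + s *: z'.1, (1 - s) *: z.2 + s *: z'.2))
  (lagrangian S_ A B sigma S tau2 rho) (argmin_dist sigma rho)
  (lagrangian_argmin S_ A B sigma rho) C
  (- ((tau2 - tau1) / 2)) ((tau2 - tau1) / 2).
- exists (0, 0); split => /=; first exact: psdmx0.
    by rewrite mxtrace0 ltW.
  exact: ellitope0 eT.
- by move=> s z z' s01; exact: (saddle_domain_mix eT s01).
- by move=> s y z z' _ _ _; exact: lagrangian_mix.
- by move=> y y'; exact: argmin_dist_ge0.
- move=> z z' [pz _ _] _; apply: lagrangian_strong => //.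
  by move=> k; rewrite mxE le_max lexx.
- exact: C0.
- by move=> k z z' z0; exact: lip.
- by move=> z; exact: Lneg.
- by rewrite divr_gt0// subr_gt0.
move: Lz0; rewrite addNr.
set y := lagrangian_argmin _ _ _ _ _ _ => Ly.
have y0 k : 0 <= y.2 k 0 by rewrite mxE le_max lexx.
clearbody y.
(* Because of the trace bound, [tau2 / c * sqnorm2 x] is left over in the matrix inequality; the
   shift absorbs it through [sqnorm2_le_sum_quad]. *)
pose H1 := y.1; pose l1 : 'cV[R]_K := \col_k (y.2 k 0 + tau2 * cS / c).
have shift0 : 0 <= tau2 * cS / c by rewrite divr_ge0 ?mulr_ge0//; lra.
pose tau3 := tau2 + tau2 * cS / c * (K%:R * b).
have tau3lt : tau3 < tau.
  rewrite /tau3 mulrAC -ltrBrDl ltr_pdivrMr//.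
  have -> : (tau - tau2) * c = tau2 * cS * (K%:R * b) + (tau - tau2).
    by rewrite /c; field; lra.
  lra.
have tau23 : tau2 <= tau3 by rewrite lerDl mulr_ge0// mulr_ge0.
suff /opt : feasible S_ T A B sigma S tau3 H1 l1 by rewrite leNgt tau3lt.
split; last by move=> k; rewrite mxE addr_ge0.
- apply/psdmx_block_pencil => x.
  have [->|x0] := eqVneq x 0.
    rewrite mulmx0 sqnorm20 addr_ge0//; last first.
      by rewrite mulr_ge0 ?psdS.2//; lra.
    apply: sumr_ge0 => k _; rewrite mulr_ge0 ?(ell_psd eT k).2// mxE.
    by rewrite addr_ge0.
  have xx0 : 0 < sqnorm2 x.
    rewrite lt_neqAle sqnorm2_ge0 andbT eq_sym.
    by apply: contra x0 => /eqP /sqnorm2_eq0 ->.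
  (* A rank-one covariance of the largest admissible trace, taken with [t = 0], tests the matrix
     inequality in direction [x]. *)
  pose s := c / sqnorm2 x; have s0 : 0 < s by rewrite divr_gt0.
  have tr1 : \tr (x *m x^T) = sqnorm2 x.
    by rewrite -[x *m x^T]mulmx1 quad_rank1 quadE mul1mx sqnorm2E.
  have Dx : saddle_domain T c (s *: (x *m x^T), 0).
    split => /=; [exact: psdmxZ (ltW s0) (psdmx_rank1 x)| |exact: ellitope0 eT].
    by rewrite linearZ/= tr1 /s divfK ?gt_eqF.
  have := Ly _ Dx.
  rewrite /lagrangian/= /linear_mse -/H1.
  have -> : \tr ((B - H1^T *m A) *m (s *: (x *m x^T)) *m (B - H1^T *m A)^T) =
      s * sqnorm2 ((B - H1^T *m A) *m x).
    rewrite -scalemxAr -scalemxAl linearZ/= mulmxA -[X in \tr X]mulmxA -trmx_mul.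
    by rewrite -[_ *m _^T]mulmx1 quad_rank1 quadE mul1mx sqnorm2E.
  have -> : \tr (s *: (x *m x^T) *m S) = s * quad S x.
    by rewrite -scalemxAl linearZ/= quad_rank1.
  have -> : \sum_k (y.2 k 0 * slack S_ (s *: (x *m x^T), 0) k + rho * y.2 k 0 ^+ 2) =
     - s * (\sum_k y.2 k 0 * quad (S_ k) x) + \sum_k rho * y.2 k 0 ^+ 2.
    rewrite mulr_sumr -big_split; apply: eq_bigr => k _ /=.
    by rewrite /slack/= mxE -scalemxAl linearZ/= quad_rank1; ring.
  set e := sqnorm2 (_ *m x); set g := \sum_k y.2 k 0 * _.
  have : 0 <= \sum_k rho * y.2 k 0 ^+ 2.
    by apply: sumr_ge0 => k _; rewrite mulr_ge0 ?sqr_ge0 ?ltW.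
  have : 0 <= sigma ^+ 2 * frob H1 by rewrite mulr_ge0 ?sqr_ge0 ?frob_ge0.
  set r1 := sigma ^+ 2 * _; set r2 := \sum_k rho * _ => r10 r20 main.
  have {main} : s * (e - tau2 * quad S x - g) <= tau2 by lra.
  rewrite -(@ler_pM2l _ s^-1) ?invr_gt0// mulKf ?gt_eqF// => main.
  have sV : s^-1 * tau2 <= tau2 * cS / c * \sum_k quad (S_ k) x.
    have -> : s^-1 * tau2 = tau2 / c * sqnorm2 x.
      by rewrite /s; field; rewrite !gt_eqF.
    have -> : tau2 * cS / c * \sum_k quad (S_ k) x =
      tau2 / c * (cS * \sum_k quad (S_ k) x) by field; rewrite gt_eqF.
    by rewrite ler_wpM2l// divr_ge0//; lra.
  have -> : \sum_k l1 k 0 * quad (S_ k) x =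
      g + tau2 * cS / c * \sum_k quad (S_ k) x.
    rewrite mulr_sumr -big_split; apply: eq_bigr => k _ /=.
    by rewrite mxE mulrDl.
  have : tau2 * quad S x <= tau3 * quad S x by rewrite ler_wpM2r ?psdS.2.
  lra.
- rewrite trace_tr_mul; rewrite -lerBrDl; apply: (phi_le eT) => t Tt.
  (* With zero covariance only the noise term, [dot y.2 t] and the regularization remain against
     [tau2]. *)
  have Dt : saddle_domain T c ((0 : 'M[R]_n), t).
    by split => //=; [exact: psdmx0|rewrite mxtrace0 ltW].
  have := Ly _ Dt.
  rewrite /lagrangian/= /linear_mse -/H1 mulmx0 mul0mx mxtrace0 add0r.
  rewrite mul0mx mxtrace0 addr0 mulr1.
  have -> : \sum_k (y.2 k 0 * slack S_ (0, t) k + rho * y.2 k 0 ^+ 2) =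
      dot y.2 t + \sum_k rho * y.2 k 0 ^+ 2.
    rewrite -big_split; apply: eq_bigr => k _ /=.
    by rewrite /slack/= mul0mx mxtrace0 subr0.
  have : 0 <= \sum_k rho * y.2 k 0 ^+ 2.
    by apply: sumr_ge0 => k _; rewrite mulr_ge0 ?sqr_ge0 ?ltW.
  have -> : dot l1 t = dot y.2 t + tau2 * cS / c * \sum_k t k 0.
    rewrite mulr_sumr -big_split; apply: eq_bigr => k _ /=.
    by rewrite mxE mulrDl.
  have : tau2 * cS / c * (\sum_k t k 0) <= tau2 * cS / c * (K%:R * b).
    rewrite ler_wpM2l// mulr_natl -[K in _ *+ K]card_ord -sumr_const.
    by apply: ler_sum => k _; exact: bT.
  rewrite /tau3; lra.
Qed.

End sdp_duality.

(** * Gaussian integrals on the line *)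

Section line.
Context {R : realType}.
Local Notation mu := (@lebesgue_measure R).

(** The Radon-Nikodym derivative and [normal_pdf] have the same integral over every measurable set,
    hence agree almost everywhere. *)
Lemma ge0_integral_normal_prob (m s : R) (f : measurableTypeR R -> \bar R) :
  measurable_fun setT f -> (forall x, (0 <= f x)%E) ->
  (\int[normal_prob m s]_x f x =
   \int[mu]_x (f x * (normal_pdf m s x)%:E))%E.
Proof.
move=> mf f0.
have dom : normal_prob m s `<< mu by exact: normal_prob_dominates.
rewrite -(Radon_Nikodym_SigmaFinite.change_of_variables dom)//.
apply: ae_eq_integral => //.
- apply: emeasurable_funM => //.
  exact: measurable_int (Radon_Nikodym_SigmaFinite.f_integrable dom).
- apply: emeasurable_funM => //; apply/measurable_EFinP.
  exact: measurable_normal_pdf.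
- apply: ae_eqe_mul2l => /=.
  apply: integral_ae_eq => //=.
  + exact: Radon_Nikodym_SigmaFinite.f_integrable.
  + by apply/measurable_EFinP; exact: measurable_normal_pdf.
  + by move=> E _ mE; rewrite -Radon_Nikodym_SigmaFinite.f_integral.
Qed.

(** By uniqueness of Lebesgue measure it is enough to look at half-open intervals; a reflection only
    changes which endpoint is included. *)
Lemma lebesgue_measure_affine (b : bool) (a : R) (A : set (measurableTypeR R)) :
  measurable A -> mu A = mu [set x | A (a + (-1) ^+ b * x)].
Proof.
have mphi : measurable_fun setT
    (fun x : measurableTypeR R => a + (-1) ^+ b * x : measurableTypeR R).
  by apply: measurable_funD => //; exact: measurable_funM.
move=> mA.
pose phi : {mfun measurableTypeR R >-> measurableTypeR R} :=
  HB.pack (fun x : measurableTypeR R => a + (-1) ^+ b * x : measurableTypeR R)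
    (isMeasurableFun.Build _ _ _ _ _ mphi).
rewrite -[RHS]/(pushforward mu phi A).
apply: lebesgue_measure_unique => // _ [[u v] _ <-] /=.
rewrite /pushforward lebesgue_measure_itv/=.
transitivity (mu [set` if b then `[a - v, a - u[ else `]u - a, v - a] ]).
  by case: (b) => /=; rewrite lebesgue_measure_itv/= !lte_fin ?ltrD2l ?ltrN2
    ?ltrD2r; case: ifP => // _; rewrite -!EFinB; congr EFin; ring.
congr (mu _); apply/seteqP; split => x;
  case: (b) => /=; rewrite !in_itv/= ?expr0 ?expr1;
    move=> /andP[? ?];
    apply/andP; split; lra.
Qed.

Lemma ge0_integral_lebesgue_affine (b : bool) (a : R)
    (f : measurableTypeR R -> \bar R) :
  measurable_fun setT f -> (forall x, (0 <= f x)%E) ->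
  (\int[mu]_x f (a + (-1) ^+ b * x)%R = \int[mu]_x f x)%E.
Proof.
move=> mf f0.
have mphi : measurable_fun setT
    (fun x : measurableTypeR R => a + (-1) ^+ b * x : measurableTypeR R).
  by apply: measurable_funD => //; exact: measurable_funM.
pose phi : {mfun measurableTypeR R >-> measurableTypeR R} :=
  HB.pack (fun x : measurableTypeR R => a + (-1) ^+ b * x : measurableTypeR R)
    (isMeasurableFun.Build _ _ _ _ _ mphi).
transitivity (\int[pushforward mu phi]_x f x)%E.
  by rewrite ge0_integral_pushforward.
apply: eq_measure_integral => A mA _.
by rewrite [RHS](lebesgue_measure_affine b a mA).
Qed.

Lemma normal_pdf01 (x : R) :
  normal_pdf 0 1 x = normal_peak 1 * expR (- x ^+ 2 / 2).
Proof.
by rewrite normal_pdfE ?oner_neq0// /normal_fun subr0 expr1n.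
Qed.

Lemma measurable_expRM (a c : R) :
  measurable_fun setT (fun x : measurableTypeR R => expR (a * x + c)).
Proof.
by apply: measurableT_comp => //; apply: measurable_funD.
Qed.

(* The Cameron-Martin formula, composed with the reflection [x |-> - x] when
   [b] is true. *)
Lemma integral_normal_prob_affine (b : bool) (a : R)
    (f : measurableTypeR R -> \bar R) :
  measurable_fun setT f -> (forall x, (0 <= f x)%E) ->
  (\int[normal_prob 0 1]_x f (a + (-1) ^+ b * x)%R =
   \int[normal_prob 0 1]_x (f x * (expR (a * x - a ^+ 2 / 2))%:E))%E.
Proof.
move=> mf f0.
have mg : measurable_fun setT
    (fun x : measurableTypeR R => (expR (a * x - a ^+ 2 / 2))%:E).
  by apply/measurable_EFinP; exact: measurable_expRM.
have mp : measurable_fun setT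
    (fun x : measurableTypeR R => (normal_pdf 0 1 x)%:E).
  by apply/measurable_EFinP; exact: measurable_normal_pdf.
rewrite [RHS]ge0_integral_normal_prob; last 2 first.
- exact: emeasurable_funM.
- by move=> x; rewrite mule_ge0// lee_fin expR_ge0.
rewrite -(ge0_integral_lebesgue_affine b a)/=; last 2 first.
- by do 2 apply: emeasurable_funM => //.
- by move=> x; rewrite !mule_ge0 ?lee_fin ?expR_ge0 ?normal_pdf_ge0.
rewrite ge0_integral_normal_prob//; last first.
  by apply: measurableT_comp => //; apply: measurable_funD.
apply: eq_integral => x _; rewrite -muleA -EFinM; congr (_ * _%:E)%E.
rewrite !normal_pdf01 mulrCA -expRD; congr (_ * expR _).
by case: b; rewrite ?expr0 ?expr1; lra.
Qed.

End line.

Section line_moments.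
Context {R : realType}.
Implicit Types a b c x : R.

Lemma measurable_fun_affine a b :
  measurable_fun setT (fun x : measurableTypeR R => a + b * x).
Proof. by apply: measurable_funD. Qed.

Lemma measurable_fun_expR_sq a b c :
  measurable_fun setT
    (fun x : measurableTypeR R => (expR (c * (a + b * x) ^+ 2))%:E).
Proof.
apply/measurable_EFinP; apply: measurableT_comp => //.
apply: measurable_funM => //; apply: measurable_funX.
exact: measurable_fun_affine.
Qed.

Lemma measurable_fun_sq a b :
  measurable_fun setT (fun x : measurableTypeR R => ((a + b * x) ^+ 2)%:E).
Proof.
apply/measurable_EFinP; apply: measurable_funX; exact: measurable_fun_affine.
Qed.

Lemma normal_peakM (s : R) : 0 < s -> s * normal_peak s = normal_peak 1.
Proof.
move=> s0; rewrite /normal_peak -mulrnAr sqrtrM ?sqr_ge0//.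
rewrite sqrtr_sqr gtr0_norm// expr1n mul1r invfM mulrA divff ?mul1r//.
by rewrite gt_eqF.
Qed.

Lemma integral_normal_prob_expR_sq a b c : 2 * c * b ^+ 2 < 1 ->
  (\int[normal_prob 0 1]_x (expR (c * (a + b * x) ^+ 2))%:E =
   ((Num.sqrt (1 - 2 * c * b ^+ 2))^-1 *
    expR (c * a ^+ 2 / (1 - 2 * c * b ^+ 2)))%:E)%E.
Proof.
set d := 1 - 2 * c * b ^+ 2 => cb.
have d0 : 0 < d by rewrite subr_gt0.
(* Completing the square: the integrand becomes a multiple of the Gaussian density with mean [m] and
   variance [1 / d]. *)
pose s := (Num.sqrt d)^-1.
have s0 : 0 < s by rewrite invr_gt0 sqrtr_gt0.
have s2 : s ^+ 2 = d^-1 by rewrite exprVn sqr_sqrtr// ltW.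
pose m := 2 * c * a * b / d.
rewrite ge0_integral_normal_prob; last 2 first.
- exact: measurable_fun_expR_sq.
- by move=> x; rewrite lee_fin expR_ge0.
transitivity (\int[lebesgue_measure]_x
    ((s * expR (c * a ^+ 2 / d))%:E * (normal_pdf m s x)%:E))%E.
  apply: eq_integral => x _; rewrite -!EFinM; congr EFin.
  rewrite normal_pdf01 normal_pdfE ?gt_eqF// -(normal_peakM s0) /normal_fun.
  rewrite mulrCA -!mulrA; congr (_ * _).
  rewrite [RHS]mulrCA -!expRD; congr (_ * expR _).
  have dn0 : 1 - 2 * c * b ^+ 2 != 0 by rewrite gt_eqF.
  by rewrite s2 /m /d; field.
rewrite ge0_integralZl_EFin//.
- by rewrite integral_normal_pdf mule1.
- by move=> x _; rewrite lee_fin normal_pdf_ge0.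
- by apply/measurable_EFinP; exact: measurable_normal_pdf.
- by rewrite mulr_ge0 ?expR_ge0 ?ltW.
Qed.


(** The bound is [1 + c + O(c^2)], so [c -> 0] would do; a single [c] replaces the limit. With
    [u = c * z] and [z = 1 + 4 * u], squaring gives [(1 + u)^2 (1 + 2 u) <= 1 + 4 u], false for
    [u > 0]. *)
Lemma le1_of_inv_sqrt (z : R) :
  (forall c, 0 < c -> 2 * c < 1 -> c * z + 1 <= (Num.sqrt (1 - 2 * c))^-1) ->
  z <= 1.
Proof.
move=> up; rewrite leNgt; apply/negP => z1.
pose c := (z - 1) / (4 * z).
have c0 : 0 < c by rewrite divr_gt0//; lra.
have c1 : 2 * c < 1.
  by rewrite /c mulrA ltr_pdivrMr; lra.
have := up c c0 c1.
set w := (Num.sqrt _)^-1 => czw.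
have w2 : w ^+ 2 * (1 - 2 * c) = 1.
  by rewrite exprVn sqr_sqrtr ?mulVf//; [apply/eqP|]; lra.
have cz : c * z = (z - 1) / 4 by rewrite /c; field; lra.
have zE : z = 1 + 4 * (c * z) by rewrite cz; field.
set u := c * z in czw zE.
have u0 : 0 < u by rewrite mulr_gt0//; lra.
have cE : c = u / (1 + 4 * u) by rewrite -zE /u mulfK//; lra.
have w2E : w ^+ 2 = (1 + 4 * u) / (1 + 2 * u).
  have E : 1 - 2 * c = (1 + 2 * u) / (1 + 4 * u) by rewrite cE; field; lra.
  apply: (mulIf (_ : 1 - 2 * c != 0)); first by lra.
  by rewrite w2 E; field; apply/andP; split; lra.
have : (u + 1) ^+ 2 <= w ^+ 2 by rewrite lerXn2r ?nnegrE//; lra.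
rewrite w2E ler_pdivlMr; last by lra.
have : 0 < u ^+ 3 by rewrite exprn_gt0.
have : 0 < u ^+ 2 by rewrite exprn_gt0.
have -> : (u + 1) ^+ 2 * (1 + 2 * u) =
  1 + 4 * u + 5 * u ^+ 2 + 2 * u ^+ 3 by ring.
lra.
Qed.

(** The same device, with the single value [k] for which [z = 1 - 4 * k]. *)
Lemma ge1_of_inv_sqrt (z : R) : 0 <= z ->
  (forall k, 0 < k -> 1 <= k * z + (Num.sqrt (1 + 2 * k))^-1) -> 1 <= z.
Proof.
move=> z0 lo; rewrite leNgt; apply/negP => z1.
pose k := (1 - z) / 4.
have k0 : 0 < k by rewrite divr_gt0//; lra.
have zE : z = 1 - 4 * k by rewrite /k; field.
have := lo k k0.
set v := (Num.sqrt _)^-1 => kzv.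
have v0 : 0 <= v by rewrite invr_ge0 sqrtr_ge0.
have v2 : v ^+ 2 * (1 + 2 * k) = 1.
  by rewrite exprVn sqr_sqrtr ?mulVf//; [apply/eqP|]; lra.
have kz1 : k * z <= k * 1 by rewrite ler_pM2l//; lra.
have : (1 - k * z) ^+ 2 <= v ^+ 2 by rewrite lerXn2r ?nnegrE//; lra.
rewrite -(@ler_pM2r _ (1 + 2 * k)) ?v2; last by lra.
have : 0 < k ^+ 2 by rewrite exprn_gt0.
have : 0 < k ^+ 3 by rewrite exprn_gt0.
have : 0 < k ^+ 5 by rewrite exprn_gt0.
rewrite zE.
have -> : (1 - k * (1 - 4 * k)) ^+ 2 * (1 + 2 * k) =
    1 + 5 * k ^+ 2 + 10 * k ^+ 3 + 32 * k ^+ 5 by ring.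
lra.
Qed.

(* Sandwich x^2 between (1 - exp(-k x^2)) / k and (exp(c x^2) - 1) / c, and let
   k and c tend to 0. *)
Lemma integral_normal_prob_sq :
  (\int[normal_prob 0 1]_x (x ^+ 2)%:E = 1 :> \bar R)%E.
Proof.
set y := (\int[normal_prob 0 1]_x _)%E.
have msq : measurable_fun setT (fun x : measurableTypeR R => (x ^+ 2)%:E).
  by apply/measurable_EFinP; exact: measurable_funX.
have mexp c : measurable_fun setT
    (fun x : measurableTypeR R => (expR (c * x ^+ 2))%:E).
  apply/measurable_EFinP; apply: measurableT_comp => //.
  by apply: measurable_funM.
have y0 : (0 <= y)%E by apply: integral_ge0 => x _; rewrite lee_fin sqr_ge0.
have Eexp c : 2 * c < 1 -> (\int[normal_prob 0 1]_x (expR (c * x ^+ 2))%:E =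
    ((Num.sqrt (1 - 2 * c))^-1)%:E)%E.
  move=> c1; have := @integral_normal_prob_expR_sq 0 1 c.
  rewrite !expr1n mulr1 expr0n/= mulr0 mul0r expR0 mulr1 => <- //.
  by apply: eq_integral => x _; rewrite add0r mul1r.
have scal k : 0 <= k ->
    (\int[normal_prob 0 1]_x (k * x ^+ 2)%:E = k%:E * y)%E.
  move=> k0; rewrite -ge0_integralZl_EFin//.
  by move=> x _; rewrite lee_fin sqr_ge0.
have mscal k : measurable_fun setT
    (fun x : measurableTypeR R => (k * x ^+ 2)%:E).
  by apply/measurable_EFinP; apply: measurable_funM.
have int1 : (\int[normal_prob 0 1]_(_ in [set: R]) 1 = 1 :> \bar R)%E.
  by rewrite integral_cst//= mul1e [LHS]probability_setT.
have up c : 0 < c -> 2 * c < 1 ->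
    (c%:E * y + 1 <= ((Num.sqrt (1 - 2 * c))^-1)%:E)%E.
  move=> c0 c1; rewrite -(scal _ (ltW c0)) -[X in (_ + X)%E]int1 -ge0_integralD//.
  - rewrite -Eexp//; apply: ge0_le_integral => //.
    + by move=> x _; rewrite adde_ge0// lee_fin mulr_ge0 ?sqr_ge0 ?ltW.
    + by apply: emeasurable_funD => //; exact: measurable_cst.
    + by move=> x _; rewrite -EFinD lee_fin addrC expR_ge1Dx.
  - by move=> x _; rewrite lee_fin mulr_ge0 ?sqr_ge0 ?ltW.
have lo k : 0 < k -> (1 <= k%:E * y + ((Num.sqrt (1 + 2 * k))^-1)%:E)%E.
  move=> k0; have := Eexp (- k); rewrite mulrN opprK => <-; last by lra.
  rewrite -(scal _ (ltW k0)) -{1}int1 -ge0_integralD//.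
  - apply: ge0_le_integral => //.
    + by apply: emeasurable_funD.
    + move=> x _; rewrite -EFinD lee_fin.
      by have := expR_ge1Dx (- k * x ^+ 2); lra.
  - by move=> x _; rewrite lee_fin mulr_ge0 ?sqr_ge0 ?ltW.
have [z yz] : exists z, y = z%:E.
  have u1 : 0 < 1 / 4 :> R by lra.
  have u2 : 2 * (1 / 4) < 1 :> R by lra.
  have := up (1 / 4) u1 u2; move: y0; case: (y) => [z| |]//= _.
    by exists z.
  by rewrite gt0_muley ?lte_fin.
have z0 : 0 <= z by rewrite yz lee_fin in y0.
rewrite yz; congr EFin; apply/eqP; rewrite eq_le; apply/andP; split.
  apply: le1_of_inv_sqrt => c c0 c1.
  by have := up c c0 c1; rewrite yz -EFinM -EFinD lee_fin.
apply: ge1_of_inv_sqrt => // k k0.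
by have := lo k k0; rewrite yz -EFinM -EFinD lee_fin.
Qed.

(** Adding the integral reflected by [x |-> - x], which has the same value, cancels the cross term,
    so that only nonnegative integrands occur. *)
Lemma integral_normal_prob_affine_sq a b :
  (\int[normal_prob 0 1]_x ((a + b * x) ^+ 2)%:E = (a ^+ 2 + b ^+ 2)%:E)%E.
Proof.
have sym : (\int[normal_prob 0 1]_x ((a + b * x) ^+ 2)%:E =
    \int[normal_prob 0 1]_x ((a + - b * x) ^+ 2)%:E)%E.
  have := @integral_normal_prob_affine R true 0
    (fun x => ((a + b * x) ^+ 2)%:E) (measurable_fun_sq a b).
  rewrite (_ : (fun _ => _) = fun x => ((a + - b * x) ^+ 2)%:E); last first.
    by apply/funext => x; rewrite expr1 add0r mulN1r mulrN mulNr.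
  move=> ->; last by move=> x; rewrite lee_fin sqr_ge0.
  by apply: eq_integral => x _; rewrite mul0r expr0n/= mul0r subr0 expR0 mule1.
have : ((\int[normal_prob 0 1]_x ((a + b * x) ^+ 2)%:E) +
    (\int[normal_prob 0 1]_x ((a + - b * x) ^+ 2)%:E) =
    (2 * (a ^+ 2 + b ^+ 2))%:E)%E.
  rewrite -ge0_integralD//; first last.
  - exact: measurable_fun_sq.
  - by move=> x _; rewrite lee_fin sqr_ge0.
  - exact: measurable_fun_sq.
  - by move=> x _; rewrite lee_fin sqr_ge0.
  transitivity (\int[normal_prob 0 1]_x
      ((2 * a ^+ 2)%:E + (2 * b ^+ 2)%:E * (x ^+ 2)%:E))%E.
    by apply: eq_integral => x _; rewrite -EFinM -!EFinD; congr EFin; ring.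
  have a0 : 0 <= 2 * a ^+ 2 by rewrite mulr_ge0 ?sqr_ge0.
  have b0 : 0 <= 2 * b ^+ 2 by rewrite mulr_ge0 ?sqr_ge0.
  have msq : measurable_fun setT (fun x : measurableTypeR R => (x ^+ 2)%:E).
    by apply/measurable_EFinP; exact: measurable_funX.
  rewrite ge0_integralD//; last 2 first.
  - by move=> x _; rewrite -EFinM lee_fin (mulr_ge0 b0 (sqr_ge0 _)).
  - by apply/measurable_EFinP; apply: measurable_funM => //.
  rewrite ge0_integralZl_EFin//; last first.
    by move=> x _; rewrite lee_fin sqr_ge0.
  rewrite integral_normal_prob_sq integral_cst//= mule1.
  by rewrite [X in (_ * X)%E]probability_setT mule1 -EFinD mulrDr.
rewrite -sym; case: (\int[_]_x _)%E => [r| |]//.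
by rewrite -EFinD => -[rE]; congr EFin; lra.
Qed.

End line_moments.

(** * Gaussian vectors *)

Section gaussian_vectors.
Context {R : realType}.
Implicit Types a c : R.

Lemma tnth_tcons0 m (x : R) (t : m.-tuple R) :
  tnth (@tcons R m (x, t)) ord0 = x.
Proof. by []. Qed.

Lemma tnth_tconsS m (x : R) (t : m.-tuple R) i :
  tnth (@tcons R m (x, t)) (lift ord0 i) = tnth t i.
Proof. by rewrite /tcons tnthS. Qed.

Lemma ge0_integral_std_gaussian0 (f : 0.-tuple (measurableTypeR R) -> \bar R) :
  (\int[std_gaussian 0]_t f t = f [tuple])%E.
Proof.
have -> : f = cst (f [tuple]) by apply/funext => t; rewrite (tuple0 t).
by rewrite /= integral_dirac// diracT mul1e.
Qed.


Lemma ge0_integral_std_gaussianS m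
    (f : m.+1.-tuple (measurableTypeR R) -> \bar R) :
  measurable_fun setT f -> (forall t, (0 <= f t)%E) ->
  (\int[std_gaussian m.+1]_t f t =
   \int[normal_prob 0 1]_x \int[std_gaussian m]_t f (tcons (x, t)))%E.
Proof.
move=> mf f0 /=.
rewrite ge0_integral_distribution//.
rewrite -(fubini_tonelli1 (f \o @tcons R m))//.
- by apply: measurableT_comp => //; exact: measurable_tcons.
- by move=> x; exact: f0.
Qed.

Lemma measurable_tcons_pair m d (T : measurableType d)
   (g : T -> measurableTypeR R) (h : T -> m.-tuple (measurableTypeR R)) :
  measurable_fun setT g -> measurable_fun setT h ->
  measurable_fun setT (fun x => tcons (g x, h x)).
Proof. by move=> mg mh; exact: measurable_cons. Qed.

Lemma measurable_integral_std_gaussian m d (T : measurableType d)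
    (f : T * m.-tuple (measurableTypeR R) -> \bar R) :
  measurable_fun setT f -> (forall z, (0 <= f z)%E) ->
  measurable_fun setT (fun x => \int[std_gaussian m]_t f (x, t))%E.
Proof.
move=> mf f0.
exact: (measurable_fun_fubini_tonelli_F (m2 := std_gaussian m)).
Qed.

Lemma measurable_dot m (u : 'I_m -> R) :
  measurable_fun setT
    (fun t : m.-tuple (measurableTypeR R) => \sum_i u i * tnth t i).
Proof.
apply: measurable_sum => i; apply: measurable_funM => //.
exact: measurable_tnth.
Qed.

Lemma dot_tcons m (u : 'I_m.+1 -> R) (x : R) (t : m.-tuple R) :
  \sum_i u i * tnth (@tcons R m (x, t)) i =
  u ord0 * x + \sum_i u (lift ord0 i) * tnth t i.
Proof.
rewrite big_ord_recl tnth_tcons0; congr (_ + _).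
by apply: eq_bigr => i _; rewrite tnth_tconsS.
Qed.

Lemma integral_std_gaussian_sq m (u : 'I_m -> R) a :
  (\int[std_gaussian m]_t ((a + \sum_i u i * tnth t i) ^+ 2)%:E =
   (a ^+ 2 + \sum_i u i ^+ 2)%:E)%E.
Proof.
elim: m u a => [|m IH] u a.
  by rewrite ge0_integral_std_gaussian0 !big_ord0 !addr0.
rewrite ge0_integral_std_gaussianS; last 2 first.
- apply/measurable_EFinP/measurable_funX; apply: measurable_funD => //.
  exact: measurable_dot.
- by move=> t; rewrite lee_fin sqr_ge0.
under eq_integral => x _.
  under eq_integral => t _ do rewrite dot_tcons addrA.
  rewrite IH EFinD; over.
rewrite ge0_integralD//; last 3 first.
- by move=> x _; rewrite lee_fin sqr_ge0.
- exact: measurable_fun_sq.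
- by move=> x _; rewrite lee_fin sumr_ge0// => i _; rewrite sqr_ge0.
rewrite integral_normal_prob_affine_sq integral_cst//=.
by rewrite [X in (_ * X)%E]probability_setT mule1 -EFinD big_ord_recl addrA.
Qed.

(** Integrating out all coordinates but the first leaves a one-dimensional integral of the same
    kind, with [c] replaced by [c / (1 - 2 * c * s)]; the offset [a] absorbs the first coordinate in
    the induction. *)
Lemma integral_std_gaussian_expR_sq m (u : 'I_m -> R) a c : 0 <= c ->
  2 * c * (\sum_i u i ^+ 2) < 1 ->
  (\int[std_gaussian m]_t (expR (c * (a + \sum_i u i * tnth t i) ^+ 2))%:E =
   ((Num.sqrt (1 - 2 * c * \sum_i u i ^+ 2))^-1 *
    expR (c * a ^+ 2 / (1 - 2 * c * \sum_i u i ^+ 2)))%:E)%E.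
Proof.
move=> c0; elim: m u a => [|m IH] u a.
  rewrite ge0_integral_std_gaussian0 !big_ord0 !addr0 mulr0 subr0 sqrtr1.
  by rewrite invr1 mul1r mulr1.
rewrite big_ord_recl /=; set s := (X in _ + X) => cs.
have s0 : 0 <= s by apply: sumr_ge0 => i _; exact: sqr_ge0.
have cu0 : 0 <= c * u ord0 ^+ 2 by rewrite mulr_ge0 ?sqr_ge0.
have d0 : 0 < 1 - 2 * c * s by move: cs; rewrite mulrDr; lra.
rewrite ge0_integral_std_gaussianS; last 2 first.
- apply/measurable_EFinP; apply: measurableT_comp => //.
  apply: measurable_funM => //; apply: measurable_funX.
  by apply: measurable_funD => //; exact: measurable_dot.
- by move=> t; rewrite lee_fin expR_ge0.
under eq_integral => x _.
  under eq_integral => t _ do rewrite dot_tcons addrA.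
  rewrite IH; last by rewrite -subr_gt0.
  rewrite -/s [c * _ / _]mulrAC EFinM; over.
have k0 : 0 <= (Num.sqrt (1 - 2 * c * s))^-1 by rewrite invr_ge0 sqrtr_ge0.
rewrite ge0_integralZl_EFin//; last exact: measurable_fun_expR_sq.
have E : 1 - 2 * (c / (1 - 2 * c * s)) * u ord0 ^+ 2 =
    (1 - 2 * c * (u ord0 ^+ 2 + s)) / (1 - 2 * c * s).
  by field; rewrite gt_eqF.
have d1 : 0 < 1 - 2 * c * (u ord0 ^+ 2 + s) by rewrite subr_gt0.
rewrite integral_normal_prob_expR_sq; last by rewrite -subr_gt0 E divr_gt0.
rewrite E -EFinM mulrA; congr (_ * expR _)%:E.
  rewrite -invfM -sqrtrM ?ltW//; congr (Num.sqrt _)^-1.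
  by rewrite mulrCA divff ?mulr1// gt_eqF.
by field; rewrite !gt_eqF.
Qed.

(** Coordinatewise Cameron-Martin formula; for [b] true the map is the reflection about [a / 2]. *)
Lemma integral_std_gaussian_affine (b : bool) m (a : 'I_m -> R)
    (f : m.-tuple (measurableTypeR R) -> \bar R) :
  measurable_fun setT f -> (forall t, (0 <= f t)%E) ->
  (\int[std_gaussian m]_t f [tuple a i + (-1) ^+ b * tnth t i | i < m]%R =
   \int[std_gaussian m]_t
     (f t * (expR (\sum_i a i * tnth t i - (\sum_i a i ^+ 2) / 2))%:E))%E.
Proof.
elim: m a f => [|m IH] a f mf f0.
  rewrite !ge0_integral_std_gaussian0 !big_ord0 mul0r subr0 expR0 mule1.
  by congr f; rewrite [LHS]tuple0.
have mshift k (a' : 'I_k -> R) : measurable_fun setT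
    (fun t : k.-tuple (measurableTypeR R) =>
      [tuple a' i + (-1) ^+ b * tnth t i | i < k] : k.-tuple (measurableTypeR R)).
  apply/measurable_fun_tnthP => i.
  rewrite (_ : _ \o _ = fun t => a' i + (-1) ^+ b * tnth t i); last first.
    by apply/funext => t /=; rewrite tnth_mktuple.
  apply: measurable_funD => //; apply: measurable_funM => //.
  exact: measurable_tnth.
have mexp k (a' : 'I_k -> R) : measurable_fun setT
    (fun t : k.-tuple (measurableTypeR R) =>
      (expR (\sum_i a' i * tnth t i - (\sum_i a' i ^+ 2) / 2))%:E).
  apply/measurable_EFinP; apply: measurableT_comp => //.
  by apply: measurable_funB => //; exact: measurable_dot.
rewrite [LHS]ge0_integral_std_gaussianS//; last exact: (measurableT_comp mf (mshift _ a)).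
rewrite [RHS]ge0_integral_std_gaussianS; last 2 first.
- by apply: emeasurable_funM => //; exact: mexp.
- by move=> t; rewrite mule_ge0// lee_fin expR_ge0.
pose w (t : m.-tuple (measurableTypeR R)) :=
  expR (\sum_i a (lift ord0 i) * tnth t i - (\sum_i a (lift ord0 i) ^+ 2) / 2).
have mg : measurable_fun setT
   (fun z : measurableTypeR R * m.-tuple (measurableTypeR R) =>
    (f (tcons z) * (w z.2)%:E)%E).
  apply: emeasurable_funM.
    by apply: measurableT_comp => //; exact: measurable_tcons.
  by apply: (measurableT_comp (mexp _ _)).
pose h x := (\int[std_gaussian m]_t (f (tcons (x, t)) * (w t)%:E))%E.
transitivity (\int[normal_prob 0 1]_x h (a ord0 + (-1) ^+ b * x)%R)%E.
  apply: eq_integral => x _; rewrite /h.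
  rewrite -(IH _ (fun t => f (tcons (a ord0 + (-1) ^+ b * x, t))))//; last first.
    by apply: measurableT_comp => //; exact: measurable_tcons_pair.
  apply: eq_integral => t _; congr f; apply: eq_from_tnth => i.
  rewrite tnth_mktuple; case: (unliftP ord0 i) => [j|] ->.
    by rewrite !tnth_tconsS tnth_mktuple.
  by rewrite !tnth_tcons0.
rewrite integral_normal_prob_affine; last 2 first.
- apply: (measurable_integral_std_gaussian mg) => t.
  by rewrite mule_ge0 ?lee_fin ?expR_ge0.
- by move=> x; apply: integral_ge0 => t _; rewrite mule_ge0// lee_fin expR_ge0.
apply: eq_integral => x _.
rewrite /h -ge0_integralZr//; last 2 first.
- exact: (measurableT_comp mg (pair1_measurable x)).
- by move=> t _; rewrite mule_ge0// lee_fin expR_ge0.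
apply: eq_integral => t _.
rewrite -muleA -EFinM -expRD; congr (_ * (expR _)%:E)%E.
by rewrite dot_tcons big_ord_recl; lra.
Qed.

End gaussian_vectors.

(** * Borel estimates *)

Section borel_vectors.
Context {R : realType}.

Local Notation borelV m := (g_sigma_algebraType (@open 'cV[R]_m)).

(** A countable base: [borel_fun] refers to the open sets of column vectors, whereas Gaussian tuples
    carry the product sigma-algebra. *)
Definition rational_box m (p : 'cV[rat]_m * nat) : set 'cV[R]_m :=
  [set v | forall i, `|v i 0 - ratr (p.1 i 0)| < p.2.+1%:R^-1].

Lemma open_bigcup_rational_box m (U : set 'cV[R]_m) : open U ->
  U = \bigcup_p (if `[< rational_box p `<=` U >] then rational_box p else set0).
Proof.
move=> oU; apply/seteqP; split; last first.
  by move=> v [p _]; case: asboolP => // pU; exact: pU.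
move=> v Uv; have /nbhs_ballP[e /= e0 eU] := open_nbhs_nbhs (conj oU Uv).
have [k ke] : exists k, k.+1%:R^-1 < e / 2 :> R.
  have e20 : 0 < e / 2 by rewrite divr_gt0.
  by have [k] := ltr_add_invr e20; rewrite add0r => ke; exists k.
have k0 : 0 < k.+1%:R^-1 :> R by rewrite invr_gt0.
have /choice[q qP] : forall i, exists q : rat, `|v i 0 - ratr q| < k.+1%:R^-1.
  move=> i; have [q] : exists q, ratr q \in `]v i 0, v i 0 + k.+1%:R^-1[.
    by apply: rat_in_itvoo; rewrite ltrDl.
  rewrite in_itv/= => /andP[q1 q2]; exists q.
  by rewrite ltr0_norm ?subr_lt0// opprB ltrBlDl.
exists (\col_i q i, k) => //=; case: asboolP => [_|].
  by move=> i /=; rewrite mxE.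
move=> []; move=> u /= uq; apply: eU; split => // i j; rewrite ord1.
rewrite /ball/= (_ : v i 0 - u i 0 =
   (v i 0 - ratr (q i)) - (u i 0 - ratr (q i))); last by ring.
rewrite (le_lt_trans (ler_normB _ _))// (lt_le_trans (ltrD (qP i) (_ : _ < k.+1%:R^-1)))//.
  by have := uq i; rewrite mxE.
by rewrite [leRHS](splitr e) lerD// ltW.
Qed.

Lemma measurable_fun_borelV d (T : measurableType d) m (f : T -> 'cV[R]_m) :
  (forall i, measurable_fun setT (fun x => f x i 0 : measurableTypeR R)) ->
  measurable_fun setT (f : T -> borelV m).
Proof.
move=> mf; apply: measurability => // _ [U oU <-]; rewrite setTI.
rewrite (open_bigcup_rational_box oU) preimage_bigcup.
apply: countable_bigcupT_measurable => // p.
case: asboolP => _; last by rewrite preimage_set0.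
rewrite (_ : _ @^-1` _ = \bigcap_(i in [set: 'I_m])
    [set x | `|f x i 0 - ratr (p.1 i 0)| < p.2.+1%:R^-1]); last first.
  by apply/seteqP; split => x /= H i => [_|]; exact: H.
apply: fin_bigcap_measurable => // i _.
have := @measurable_fun_ltr _ T R setT (fun x => `|f x i 0 - ratr (p.1 i 0)|)
  (cst p.2.+1%:R^-1).
move=> /(_ _ _ measurableT [set true]); rewrite setTI; apply => //.
apply: (measurableT_comp (f := fun x : measurableTypeR R => `|x| : measurableTypeR R)) => //.
- exact: normr_measurable.
- by apply: measurable_funB => //; exact: mf.
Qed.

Lemma measurable_coord m i :
  measurable_fun setT (fun v : borelV m => v i 0 : measurableTypeR R).
Proof.
apply: (measurability _ (RGenOpens.measurableE R)).
move=> _ [_ [a [b ->] <-]]; rewrite setTI; apply: sub_sigma_algebra.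
apply: open_comp; last exact: interval_open.
by move=> v _; exact: coord_continuous.
Qed.

Lemma borel_fun_coord m nu (w : 'cV[R]_m -> 'cV[R]_nu) i : borel_fun w ->
  measurable_fun setT (fun v : borelV m => w v i 0 : measurableTypeR R).
Proof. by move=> mw; exact: (measurableT_comp (measurable_coord i) mw). Qed.

Lemma measurable_sqnorm2 d (T : measurableType d) m (f : T -> 'cV[R]_m) :
  (forall i, measurable_fun setT (fun x => f x i 0 : measurableTypeR R)) ->
  measurable_fun setT (fun x => sqnorm2 (f x) : measurableTypeR R).
Proof.
by move=> mf; apply: measurable_sum => i; apply: measurable_funX; exact: mf.
Qed.

Lemma measurable_mulmx_coord d (T : measurableType d) m n (M : 'M[R]_(n, m))
    (f : T -> 'cV[R]_m) :
  (forall i, measurable_fun setT (fun x => f x i 0 : measurableTypeR R)) ->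
  forall i, measurable_fun setT (fun x => (M *m f x) i 0 : measurableTypeR R).
Proof.
move=> mf i; under eq_fun do rewrite mxE.
by apply: measurable_sum => j; apply: measurable_funM => //; exact: mf.
Qed.

Lemma measurable_add_coord d (T : measurableType d) m
    (f g : T -> 'cV[R]_m) :
  (forall i, measurable_fun setT (fun x => f x i 0 : measurableTypeR R)) ->
  (forall i, measurable_fun setT (fun x => g x i 0 : measurableTypeR R)) ->
  forall i, measurable_fun setT (fun x => (f x + g x) i 0 : measurableTypeR R).
Proof.
by move=> mf mg i; under eq_fun do rewrite mxE; apply: measurable_funD;
  [exact: mf|exact: mg].
Qed.

Lemma measurable_sub_coord d (T : measurableType d) m
    (f g : T -> 'cV[R]_m) :
  (forall i, measurable_fun setT (fun x => f x i 0 : measurableTypeR R)) ->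
  (forall i, measurable_fun setT (fun x => g x i 0 : measurableTypeR R)) ->
  forall i, measurable_fun setT (fun x => (f x - g x) i 0 : measurableTypeR R).
Proof.
by move=> mf mg i; under eq_fun do rewrite !mxE; apply: measurable_funB;
  [exact: mf|exact: mg].
Qed.

Lemma measurable_scale_coord d (T : measurableType d) m
    (k : T -> R) (f : T -> 'cV[R]_m) :
  measurable_fun setT (k : T -> measurableTypeR R) ->
  (forall i, measurable_fun setT (fun x => f x i 0 : measurableTypeR R)) ->
  forall i, measurable_fun setT (fun x => (k x *: f x) i 0 : measurableTypeR R).
Proof.
by move=> mk mf i; under eq_fun do rewrite mxE; apply: measurable_funM => //;
  exact: mf.
Qed.

Lemma measurable_col_of_tuple m i :
  measurable_fun setT (fun t : m.-tuple (measurableTypeR R) =>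
    col_of_tuple t i 0 : measurableTypeR R).
Proof. by under eq_fun do rewrite mxE; exact: measurable_tnth. Qed.

End borel_vectors.

(** * Bayes risk of a Gaussian signal *)

Section bayes.
Context {R : realType}.
Local Notation tuples m := (m.-tuple (measurableTypeR R)).

(** Applied with [f2] a reflected version of [f1]; doubling avoids subtracting possibly infinite
    integrals. *)
Lemma ge0_le_integral_average d (T : measurableType d)
    (mu : {measure set T -> \bar R}) (f1 f2 h : T -> \bar R) :
  measurable_fun setT f1 -> measurable_fun setT f2 -> measurable_fun setT h ->
  (forall x, (0 <= f1 x)%E) -> (forall x, (0 <= f2 x)%E) ->
  (forall x, (0 <= h x)%E) ->
  (\int[mu]_x f1 x = \int[mu]_x f2 x)%E ->
  (forall x, (2%:E * h x <= f1 x + f2 x)%E) ->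
  (\int[mu]_x h x <= \int[mu]_x f1 x)%E.
Proof.
move=> mf1 mf2 mh f10 f20 h0 f12 le; rewrite -(@lee_pmul2l _ 2%:E)//.
rewrite [leRHS]mule_natl mule2n [X in (_ <= _ + X)%E]f12 -ge0_integralD//.
rewrite -ge0_integralZl_EFin//.
apply: ge0_le_integral => //.
- by move=> x _; rewrite mule_ge0.
- exact: emeasurable_funM.
- exact: emeasurable_funD.
Qed.

Lemma integral_std_gaussian_sqnorm2 m n (M : 'M[R]_(m, n)) (v : 'cV[R]_m) :
  (\int[std_gaussian n]_t (sqnorm2 (v + M *m col_of_tuple t))%:E =
   (sqnorm2 v + frob M)%:E)%E.
Proof.
transitivity (\int[std_gaussian n]_t
    \sum_(i < m) ((v i 0 + \sum_j M i j * tnth t j) ^+ 2)%:E)%E.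
  apply: eq_integral => t _; rewrite sumEFin; congr EFin.
  apply: eq_bigr => i _; rewrite !mxE; congr ((_ + _) ^+ 2).
  by apply: eq_bigr => j _; rewrite mxE.
rewrite ge0_integral_sum//; last 2 first.
- move=> i; apply/measurable_EFinP/measurable_funX; apply: measurable_funD => //.
  exact: measurable_dot.
- by move=> i t _; rewrite lee_fin sqr_ge0.
under eq_bigr do rewrite integral_std_gaussian_sq.
by rewrite sumEFin big_split.
Qed.

Lemma integral_std_gaussian2_sqnorm2 m n p (M : 'M[R]_(m, n)) (N : 'M[R]_(m, p)) :
  (\int[std_gaussian n]_g \int[std_gaussian p]_t
      (sqnorm2 (M *m col_of_tuple g + N *m col_of_tuple t))%:E =
   (frob M + frob N)%:E)%E.
Proof.
under eq_integral do rewrite integral_std_gaussian_sqnorm2 EFinD.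
rewrite ge0_integralD//; last 3 first.
- by move=> g _; rewrite lee_fin sqnorm2_ge0.
- apply/measurable_EFinP; apply: measurable_sqnorm2.
  by apply: measurable_mulmx_coord; exact: measurable_col_of_tuple.
- by move=> g _; rewrite lee_fin frob_ge0.
rewrite integral_cst//= [X in (_ * X)%E]probability_setT mule1.
under eq_integral do rewrite -[_ *m _]add0r.
rewrite integral_std_gaussian_sqnorm2 -EFinD sqnorm2E dot0r add0r.
by [].
Qed.

Lemma measurable_expR_dot n m (A : 'M[R]_(m, n)) :
  measurable_fun setT (fun z : tuples n * tuples m =>
    (expR (dot (A *m col_of_tuple z.1) (col_of_tuple z.2) -
           sqnorm2 (A *m col_of_tuple z.1) / 2))%:E).
Proof.
have mA i : measurable_fun setT (fun z : tuples n * tuples m =>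
    (A *m col_of_tuple z.1) i 0 : measurableTypeR R).
  apply: measurable_mulmx_coord => j.
  exact: (measurableT_comp (measurable_col_of_tuple j)).
apply/measurable_EFinP; apply: measurableT_comp => //.
apply: measurable_funB.
  apply: measurable_sum => i; apply: measurable_funM; first exact: mA.
  exact: (measurableT_comp (measurable_col_of_tuple i)).
by apply: measurable_funM => //; exact: measurable_sqnorm2.
Qed.

Lemma col_of_tuple_affine m b (a : 'cV[R]_m) (t : tuples m) :
  col_of_tuple [tuple a i 0 + (-1) ^+ b * tnth t i | i < m] =
  a + (-1) ^+ b *: col_of_tuple t.
Proof. by apply/colP => i; rewrite !mxE tnth_mktuple. Qed.

Lemma integral_std_gaussian_shift (b : bool) m (a : 'cV[R]_m)
    (f : 'cV[R]_m -> \bar R) :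
  measurable_fun setT (fun t : tuples m => f (col_of_tuple t)) ->
  (forall v, (0 <= f v)%E) ->
  (\int[std_gaussian m]_t f (a + (-1) ^+ b *: col_of_tuple t)%R =
   \int[std_gaussian m]_t (f (col_of_tuple t) *
      (expR (dot a (col_of_tuple t) - sqnorm2 a / 2))%:E))%E.
Proof.
move=> mf f0.
have := @integral_std_gaussian_affine R b m (fun i => a i 0)
  (fun t => f (col_of_tuple t)) mf (fun t => f0 _).
under [in X in X = _ -> _]eq_integral do rewrite col_of_tuple_affine.
move=> ->; apply: eq_integral => t _.
suff -> : \sum_i a i 0 * tnth t i = dot a (col_of_tuple t) by [].
by apply: eq_bigr => i _; rewrite mxE.
Qed.

(* Change of measure making the observation [A g + xi] independent of [g]. *)
Lemma integral_gaussian_channel n m (A : 'M[R]_(m, n))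
    (F : 'cV[R]_n -> 'cV[R]_m -> \bar R) :
  measurable_fun setT (fun z : tuples n * tuples m =>
     F (col_of_tuple z.1) (col_of_tuple z.2)) ->
  (forall u v, (0 <= F u v)%E) ->
  (\int[std_gaussian n]_g \int[std_gaussian m]_t
     F (col_of_tuple g) (A *m col_of_tuple g + col_of_tuple t)%R =
   \int[std_gaussian m]_t \int[std_gaussian n]_g
     (F (col_of_tuple g) (col_of_tuple t) *
      (expR (dot (A *m col_of_tuple g) (col_of_tuple t) -
             sqnorm2 (A *m col_of_tuple g) / 2))%:E))%E.
Proof.
move=> mF F0.
rewrite -(fubini_tonelli (fun z => (F (col_of_tuple z.1) (col_of_tuple z.2) *
      (expR (dot (A *m col_of_tuple z.1) (col_of_tuple z.2) -
             sqnorm2 (A *m col_of_tuple z.1) / 2))%:E)%E)); last 2 first.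
- by apply: emeasurable_funM => //; exact: measurable_expR_dot.
- by move=> z; rewrite mule_ge0// lee_fin expR_ge0.
apply: eq_integral => g _.
have := @integral_std_gaussian_shift false m (A *m col_of_tuple g)
  (F (col_of_tuple g)) (measurableT_comp mF (pair1_measurable g)) (F0 _).
by under [in X in X = _ -> _]eq_integral do rewrite expr0 scale1r.
Qed.

(* For standard Gaussian [g] and [xi], the conditional expectation of [g] given
   [A *m g + xi = v] is [posterior_mean A *m v]. *)
Definition posterior_mean n m (A : 'M[R]_(m, n)) : 'M[R]_(n, m) :=
  invmx (1%:M + A^T *m A) *m A^T.

Lemma posterior_meanP n m (A : 'M[R]_(m, n)) (v : 'cV[R]_m) :
  let c := posterior_mean A *m v in c + A^T *m (A *m c) = A^T *m v.
Proof.
move=> c; rewrite mulmxA -{1}[c]mul1mx -mulmxDl /c /posterior_mean !mulmxA.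
rewrite mulmxV ?mul1mx//; apply: pdmx_unit => x x0.
rewrite quadE mulmxDl mul1mx dotDr -mulmxA dot_mulmxr trmxK -!sqnorm2E.
rewrite ltr_wpDr ?sqnorm2_ge0// lt_neqAle sqnorm2_ge0 andbT eq_sym.
by apply: contra x0 => /eqP /sqnorm2_eq0 ->.
Qed.

(* Given the observation [v], the law of [g] is symmetric about its posterior
   mean [c]; averaging the loss over [g] and [2 c - g] and the parallelogram law
   show that [B c] is an optimal estimate of [B g]. *)
Lemma gaussian_bayes_risk n m nu (A : 'M[R]_(m, n)) (B : 'M[R]_(nu, n))
    (w : 'cV[R]_m -> 'cV[R]_nu) : borel_fun w ->
  ((frob (B - B *m posterior_mean A *m A) + frob (B *m posterior_mean A))%:E <=
   \int[std_gaussian n]_g \int[std_gaussian m]_t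
     (sqnorm2 (w (A *m col_of_tuple g + col_of_tuple t) -
               B *m col_of_tuple g))%:E)%E.
Proof.
move=> mw; set C := posterior_mean A.
have mg d (T : measurableType d) k (h : T -> tuples k) i :
    measurable_fun setT h ->
    measurable_fun setT (fun x => col_of_tuple (h x) i 0 : measurableTypeR R).
  by move=> mh; exact: (measurableT_comp (measurable_col_of_tuple i)).
have mF : measurable_fun setT (fun z : tuples n * tuples m =>
    (sqnorm2 (w (col_of_tuple z.2) - B *m col_of_tuple z.1))%:E).
  apply/measurable_EFinP; apply: measurable_sqnorm2.
  apply: measurable_sub_coord => i.
    apply: (measurableT_comp (borel_fun_coord i mw)).
    by apply: measurable_fun_borelV => j; exact: mg.
  by apply: measurable_mulmx_coord => j; exact: mg.
have mG : measurable_fun setT (fun z : tuples n * tuples m =>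
    (sqnorm2 (B *m (col_of_tuple z.1 - C *m col_of_tuple z.2)))%:E).
  apply/measurable_EFinP; apply: measurable_sqnorm2.
  apply: measurable_mulmx_coord; apply: measurable_sub_coord => i.
    exact: mg.
  by apply: measurable_mulmx_coord => j; exact: mg.
(* The left side is the risk of the posterior mean, so both sides undergo the same change of measure
   and can be compared observation by observation. *)
have -> : ((frob (B - B *m C *m A) + frob (B *m C))%:E =
    \int[std_gaussian n]_g \int[std_gaussian m]_t
      (sqnorm2 (B *m (col_of_tuple g -
         C *m (A *m col_of_tuple g + col_of_tuple t))))%:E)%E.
  rewrite -[frob (B *m C)](_ : frob (- (B *m C)) = _); last first.
    by rewrite -scaleN1r frobZ sqrrN expr1n mul1r.
  rewrite -integral_std_gaussian2_sqnorm2.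
  apply: eq_integral => g _; apply: eq_integral => t _; congr (sqnorm2 _)%:E.
  rewrite mulmxBl mulNmx mulmxBr !mulmxDr opprD !mulmxA addrA.
  by [].
rewrite (integral_gaussian_channel (F := fun u v =>
   (sqnorm2 (B *m (u - C *m v)))%:E) _ mG); last first.
  by move=> u v; rewrite lee_fin sqnorm2_ge0.
rewrite (integral_gaussian_channel (F := fun u v =>
   (sqnorm2 (w v - B *m u))%:E) _ mF); last first.
  by move=> u v; rewrite lee_fin sqnorm2_ge0.
have mW := measurable_expR_dot A.
have swap (f : tuples n * tuples m -> \bar R) : measurable_fun setT f ->
    measurable_fun setT (fun z : tuples m * tuples n => f (z.2, z.1)).
  move=> mf; apply: (measurableT_comp mf).
  by apply: measurable_fun_pair.
apply: ge0_le_integral => //.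
- move=> t _; apply: integral_ge0 => g _.
  by rewrite mule_ge0// lee_fin ?expR_ge0 ?sqnorm2_ge0.
- apply: (measurable_integral_std_gaussian (swap _ (emeasurable_funM mG mW))).
  by move=> z; rewrite mule_ge0// lee_fin ?expR_ge0 ?sqnorm2_ge0.
- apply: (measurable_integral_std_gaussian (swap _ (emeasurable_funM mF mW))).
  by move=> z; rewrite mule_ge0// lee_fin ?expR_ge0 ?sqnorm2_ge0.
move=> t _; set v := col_of_tuple t; pose c := C *m v.
pose W u := expR (dot (A *m u) v - sqnorm2 (A *m u) / 2).
have msec (f : tuples n * tuples m -> \bar R) : measurable_fun setT f ->
    measurable_fun setT (fun g => f (g, t)).
  by move=> mf; exact: (measurableT_comp mf (pair2_measurable t)).
have mWt : measurable_fun setT (fun g : tuples n => (W (col_of_tuple g))%:E).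
  exact: (msec _ mW).
have mWF : measurable_fun setT (fun g : tuples n =>
    ((sqnorm2 (w v - B *m col_of_tuple g))%:E * (W (col_of_tuple g))%:E)%E).
  exact: (msec _ (emeasurable_funM mF mW)).
have mWR : measurable_fun setT (fun g : tuples n =>
    ((sqnorm2 (w v - B *m (2 *: c - col_of_tuple g)))%:E *
     (W (col_of_tuple g))%:E)%E).
  apply: emeasurable_funM => //; apply/measurable_EFinP.
  apply: measurable_sqnorm2; apply: measurable_sub_coord => i //.
  apply: measurable_mulmx_coord => j.
  by apply: measurable_sub_coord => k //; exact: mg.
apply: (ge0_le_integral_average mWF mWR).
- exact: (msec _ (emeasurable_funM mG mW)).
- by move=> g; rewrite mule_ge0// lee_fin ?expR_ge0 ?sqnorm2_ge0.
- by move=> g; rewrite mule_ge0// lee_fin ?expR_ge0 ?sqnorm2_ge0.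
- by move=> g; rewrite mule_ge0// lee_fin ?expR_ge0 ?sqnorm2_ge0.
- have mr i : measurable_fun setT (fun g : tuples n =>
      (2 *: c - col_of_tuple g) i 0 : measurableTypeR R).
    by apply: measurable_sub_coord => j //; exact: mg.
  pose f u := ((sqnorm2 (w v - B *m (2 *: c - u)))%:E *
               (W (2 *: c - u))%:E)%E.
  transitivity (\int[std_gaussian n]_g
      f (2 *: c + (-1) ^+ true *: col_of_tuple g)%R)%E.
    by apply: eq_integral => g _; rewrite expr1 scaleN1r /f subKr.
  rewrite integral_std_gaussian_shift; last 2 first.
  - apply: emeasurable_funM; apply/measurable_EFinP.
      apply: measurable_sqnorm2; apply: measurable_sub_coord => i //.
      exact: measurable_mulmx_coord.
    apply: measurableT_comp => //; apply: measurable_funB.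
      apply: measurable_sum => i; apply: measurable_funM => //.
      exact: measurable_mulmx_coord.
    apply: measurable_funM => //; apply: measurable_sqnorm2.
    exact: measurable_mulmx_coord.
  - by move=> u; rewrite mule_ge0// lee_fin ?expR_ge0 ?sqnorm2_ge0.
  apply: eq_integral => g _; rewrite /f -muleA -!EFinM /W -expRD.
  congr (_ * expR _)%:E; set u := col_of_tuple g.
  (* The equation defining the posterior mean eliminates [v]; the exponents then show that [W] times
     the Gaussian density is invariant under [u |-> 2 c - u]. *)
  have AC x : dot (A *m x) v = dot x c + dot (A *m x) (A *m c).
    by rewrite dot_mulmxl -posterior_meanP dotDr [dot (A *m x) _]dot_mulmxl.
  rewrite !AC !sqnorm2E mulmxBr -!scalemxAr.
  rewrite !(dotDl, dotDr, dotNl, dotNr, dotZl, dotZr).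
  by rewrite (dotC c u) (dotC (A *m c) (A *m u)); lra.
move=> g; rewrite -!EFinM -EFinD lee_fin -mulrDl mulrA.
rewrite ler_wpM2r ?expR_ge0//; set u := col_of_tuple g.
have -> : w v - B *m u = (w v - B *m c) - B *m (u - c).
  by rewrite mulmxBr opprB addrA subrK.
have -> : w v - B *m (2 *: c - u) = (w v - B *m c) + B *m (u - c).
  by rewrite !mulmxBr -scalemxAr scaler_nat mulr2n opprB opprD !addrA addrAC.
rewrite (sqnorm2B (w v - B *m c)) (sqnorm2D (w v - B *m c)).
by have := sqnorm2_ge0 (w v - B *m c); lra.
Qed.

End bayes.

(** * Gaussian tails and truncation *)

Section gaussian_tail.
Context {R : realType}.
Local Notation tuples m := (m.-tuple (measurableTypeR R)).

(* Jensen's inequality, with the missing mass [1 - \sum_i p i] put at [0]. *)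
Lemma expR_sum_le n (p y : 'I_n -> R) : (forall i, 0 <= p i) ->
  \sum_i p i <= 1 ->
  expR (\sum_i p i * y i) <= \sum_i p i * expR (y i) + (1 - \sum_i p i).
Proof.
move=> p0 p1; set x := \sum_i p i * y i.
have tangent z : expR x * (1 + (z - x)) <= expR z.
  have -> : expR z = expR x * expR (z - x) by rewrite -expRD addrC subrK.
  by rewrite ler_wpM2l ?expR_ge0// expR_ge1Dx.
have t0 := tangent 0; rewrite expR0 in t0.
have : \sum_i p i * (expR x * (1 + (y i - x))) <= \sum_i p i * expR (y i).
  by apply: ler_sum => i _; rewrite ler_wpM2l.
have -> : \sum_i p i * (expR x * (1 + (y i - x))) =
    expR x * ((1 - x) * \sum_i p i + x).
  rewrite mulr_sumr /x -big_split mulr_sumr; apply: eq_bigr => i _ /=; ring.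
have : (1 - \sum_i p i) * (expR x * (1 + (0 - x))) <= (1 - \sum_i p i) * 1.
  by rewrite ler_wpM2l// subr_ge0.
have : (1 - \sum_i p i) * (expR x * (1 + (0 - x))) =
    expR x - expR x * ((1 - x) * \sum_i p i + x) by ring.
lra.
Qed.

Lemma dot_row_col_of_tuple m n (G : 'M[R]_(m, n)) i (t : tuples n) :
  (G *m col_of_tuple t) i 0 = \sum_j G i j * tnth t j.
Proof. by rewrite mxE; apply: eq_bigr => j _; rewrite mxE. Qed.

(* [sqrt 3] is the expectation of [exp (g^2 / 3)] for a standard Gaussian [g]. *)
Lemma integral_expR_sqnorm2_le m n (G : 'M[R]_(m, n)) : frob G <= 1 ->
  (\int[std_gaussian n]_t (expR (sqnorm2 (G *m col_of_tuple t) / 3))%:E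
   <= (Num.sqrt 3)%:E)%E.
Proof.
move=> G1.
pose p i := \sum_j G i j ^+ 2.
(* Coordinate [i] of the Gaussian vector has variance [p i], so [2 * c i * p i = 2 / 3] and each
   exponential has mean [sqrt 3]. If [p i = 0], the coordinate vanishes and [c i = 0]. *)
pose c i := (3 * p i)^-1.
have p0 i : 0 <= p i by apply: sumr_ge0 => j _; exact: sqr_ge0.
have c0 i : 0 <= c i by rewrite invr_ge0 mulr_ge0.
have sqrt3 : 1 <= Num.sqrt 3 :> R.
  by rewrite -[X in X <= _]sqrtr1 ler_sqrt; lra.
pose e i (t : tuples n) := expR (c i * (0 + \sum_j G i j * tnth t j) ^+ 2).
have me i : measurable_fun setT (fun t => (e i t)%:E).
  apply/measurable_EFinP; apply: measurableT_comp => //.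
  apply: measurable_funM => //; apply: measurable_funX.
  by apply: measurable_funD => //; exact: measurable_dot.
have Ie i : (\int[std_gaussian n]_t (e i t)%:E <= (Num.sqrt 3)%:E)%E.
  rewrite integral_std_gaussian_expR_sq//.
    rewrite expr0n/= mulr0 mul0r expR0 mulr1 lee_fin -/(p i).
    have [pE|pn0] := eqVneq (p i) 0.
      by rewrite pE mulr0 subr0 sqrtr1 invr1.
    have -> : 1 - 2 * c i * p i = 3^-1 by rewrite /c; field.
    by rewrite sqrtrV// invrK.
  rewrite -/(p i); have [->|pn0] := eqVneq (p i) 0; first by rewrite mulr0.
  by have -> : 2 * c i * p i = 2 / 3 by [rewrite /c; field]; lra.
have pt t : expR (sqnorm2 (G *m col_of_tuple t) / 3) <=
    \sum_i p i * e i t + (1 - frob G).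
  have -> : sqnorm2 (G *m col_of_tuple t) / 3 =
      \sum_i p i * (c i * (0 + \sum_j G i j * tnth t j) ^+ 2).
    rewrite mulr_suml; apply: eq_bigr => i _.
    rewrite dot_row_col_of_tuple add0r.
    have [pE|pn0] := eqVneq (p i) 0; last by rewrite /c; field.
    rewrite pE mul0r big1 ?expr0n ?mul0r// => j _.
    have : \sum_j G i j ^+ 2 == 0 by rewrite -/(p i) pE.
    rewrite psumr_eq0 => [/allP/(_ j)|k _]; last exact: sqr_ge0.
    by rewrite mem_index_enum sqrf_eq0 => /(_ isT)/eqP ->; rewrite mul0r.
  exact: expR_sum_le.
apply: (@le_trans _ _ (\int[std_gaussian n]_t
    (\sum_i (p i)%:E * (e i t)%:E + (1 - frob G)%:E)))%E.
  apply: ge0_le_integral => //.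
  - apply/measurable_EFinP; apply: measurableT_comp => //.
    apply: measurable_funM => //; apply: measurable_sqnorm2.
    by apply: measurable_mulmx_coord; exact: measurable_col_of_tuple.
  - apply: emeasurable_funD => //; apply: emeasurable_sum => i.
    exact: emeasurable_funM.
  - move=> t _; under eq_bigr do rewrite -EFinM.
    by rewrite sumEFin -EFinD lee_fin.
rewrite ge0_integralD//; last 3 first.
- by move=> t _; apply: sume_ge0 => i _; rewrite -EFinM lee_fin mulr_ge0 ?expR_ge0.
- by apply: emeasurable_sum => i; exact: emeasurable_funM.
- by move=> t _; rewrite lee_fin subr_ge0.
rewrite integral_cst//= [X in (_ * X)%E]probability_setT mule1.
rewrite ge0_integral_sum//; last 2 first.
- by move=> i; exact: emeasurable_funM.
- by move=> i t _; rewrite -EFinM lee_fin mulr_ge0 ?expR_ge0.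
apply: (@le_trans _ _ (\sum_i (p i * Num.sqrt 3)%:E + (1 - frob G)%:E))%E.
  rewrite leeD2r//; apply: lee_sum => i _.
  rewrite ge0_integralZl_EFin//; last by move=> t _; rewrite lee_fin expR_ge0.
  by rewrite EFinM; apply: lee_wpmul2l; [rewrite lee_fin|exact: Ie].
rewrite sumEFin -EFinD lee_fin -mulr_suml -/(frob G).
have : (1 - frob G) * 1 <= (1 - frob G) * Num.sqrt 3.
  by rewrite ler_wpM2l ?subr_ge0.
by rewrite mulrBl; lra.
Qed.

End gaussian_tail.

Section truncation.
Context {R : realType}.

(* The projection onto the ball of radius [M]; the quotient is 0/0 only if [M = 0]
   and [v = 0]. *)
Definition trunc n (M : R) (v : 'cV[R]_n) : 'cV[R]_n :=
  (M / Num.sqrt (Num.max (M ^+ 2) (sqnorm2 v))) *: v.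

Lemma sqnorm2_trunc n (M : R) (v : 'cV[R]_n) : 0 <= M ->
  sqnorm2 (trunc M v) <= M ^+ 2.
Proof.
move=> M0; rewrite sqnorm2Z expr_div_n sqr_sqrtr ?le_max ?sqr_ge0//.
set s := sqnorm2 v; set x := Num.max _ s.
have sx : s <= x by rewrite le_max lexx orbT.
have s0 : 0 <= s by exact: sqnorm2_ge0.
have [xE|xn0] := eqVneq x 0; first by rewrite xE invr0 mulr0 mul0r sqr_ge0.
have x0 : 0 < x by rewrite lt_neqAle eq_sym xn0 (le_trans s0 sx).
by rewrite mulrAC ler_pdivrMr// ler_wpM2l ?sqr_ge0.
Qed.

Lemma sqnorm2_truncB n (M : R) (v b : 'cV[R]_n) : 0 <= M ->
  sqnorm2 b <= M ^+ 2 -> sqnorm2 (trunc M v - b) <= sqnorm2 (v - b).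
Proof.
move=> M0 bM; rewrite /trunc; set s := sqnorm2 v.
have s0 : 0 <= s by exact: sqnorm2_ge0.
have [sM|Ms] := leP s (M ^+ 2).
  rewrite sqrtr_sqr ger0_norm//.
  have [ME|Mn0] := eqVneq M 0; last by rewrite divff// scale1r.
  have -> : v = 0 by apply: sqnorm2_eq0; apply/eqP;
    rewrite eq_le sqnorm2_ge0 andbT (le_trans sM)// ME expr0n.
  by rewrite scaler0.
pose r := Num.sqrt s.
have r2 : r ^+ 2 = s by rewrite sqr_sqrtr.
have Mr : M < r by rewrite -(@ltr_pXn2r _ 2)// ?nnegrE ?sqrtr_ge0// r2.
have r0 : 0 < r by exact: le_lt_trans Mr.
rewrite -/r; set c := M / r.
have cr : c * r = M by rewrite /c divfK// gt_eqF.
have c1 : 0 <= 1 - c by rewrite subr_ge0 ler_pdivrMr// mul1r ltW.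
have vb : dot v b <= r * M.
  apply: le_trans (ler_norm _) _.
  rewrite -(@ler_pXn2r _ 2)// ?nnegrE ?mulr_ge0 ?(ltW r0)//.
  rewrite real_normK ?num_real// (le_trans (cauchy_schwarz _ _))//.
  by rewrite exprMn r2 ler_wpM2l.
rewrite !sqnorm2B sqnorm2Z dotZl -/s -subr_ge0.
(* The gap factors, and its second factor is nonnegative because [dot v b <= r * M] and [M < r]. *)
have -> : s - 2 * dot v b + sqnorm2 b -
    (c ^+ 2 * s - 2 * (c * dot v b) + sqnorm2 b) =
    (1 - c) * (s + (c * r) * r - 2 * dot v b).
  by rewrite -r2; ring.
rewrite mulr_ge0// cr -r2.
have : 0 <= (r - M) * r by rewrite mulr_ge0 ?subr_ge0 ?(ltW Mr) ?(ltW r0).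
by rewrite expr2; lra.
Qed.

Lemma borel_trunc m n M (w : 'cV[R]_m -> 'cV[R]_n) : 0 <= M ->
  borel_fun w -> borel_fun (fun v => trunc M (w v)).
Proof.
move=> M0 mw; apply: measurable_fun_borelV.
apply: measurable_scale_coord; last by move=> i; exact: borel_fun_coord.
apply: measurable_funM => //.
have ms : measurable_fun setT (fun v : g_sigma_algebraType (@open 'cV[R]_m) =>
    Num.max (M ^+ 2) (sqnorm2 (w v)) : measurableTypeR R).
  apply: measurable_maxr => //.
  by apply: measurable_sqnorm2 => i; exact: borel_fun_coord.
rewrite (_ : (fun v => _) = fun v =>
    powR (powR (Num.max (M ^+ 2) (sqnorm2 (w v))) 2^-1) (-1)); last first.
  apply/funext => v; rewrite powR12_sqrt ?le_max ?sqr_ge0//.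
  by rewrite powR_inv1 ?sqrtr_ge0.
apply: (measurableT_comp (measurable_powR _)).
exact: (measurableT_comp (measurable_powR _)).
Qed.

Lemma borel_scale m n (k : R) (w : 'cV[R]_m -> 'cV[R]_n) :
  borel_fun w -> borel_fun (fun v => w (k *: v)).
Proof.
move=> mw; apply: (measurableT_comp mw); apply: measurable_fun_borelV.
by apply: measurable_scale_coord => // i; exact: measurable_coord.
Qed.

End truncation.

(** * The signal set and the two risk bounds *)

Section mstar.
Context {R : realType} {n nu K : nat}.
Variables (S_ : 'I_K -> 'M[R]_n) (T : set 'cV[R]_K) (B : 'M[R]_(nu, n)).
Hypothesis eT : ellitope_data S_ T.

Lemma trace_gram_row p (G : 'M[R]_(p, n)) (P : 'M[R]_n) :
  \tr (G^T *m G *m P) = \sum_i quad P (row i G)^T.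
Proof.
rewrite -mulmxA mxtrace_mulC; apply: eq_bigr => i _.
by rewrite /quad trmxK tr_row -row_mul colE mulmxA -row_mul -colE !mxE.
Qed.

Lemma ellQ_trace_bounded : exists c, forall Q, ellQ S_ T Q -> \tr Q <= c.
Proof.
have [cS cS0 cSP] := sqnorm2_le_sum_quad eT.
have [b b0 bT] := ellitope_bounded eT.
exists (cS * (\sum_(k < K) b)) => Q [psdQ [t Tt Qt]].
have [G QE] := psdmx_factor psdQ.
rewrite QE trace_tr_mul frob_row.
apply: (@le_trans _ _ (cS * \sum_k \tr (Q *m S_ k))).
  have -> : \sum_k \tr (Q *m S_ k) =
      \sum_(i < n) \sum_k quad (S_ k) (row i G)^T.
    rewrite [RHS]exchange_big; apply: eq_bigr => k _.
    by rewrite QE trace_gram_row.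
  by rewrite mulr_sumr; apply: ler_sum => i _; exact: cSP.
rewrite ler_wpM2l//; apply: ler_sum => k _.
exact: le_trans (Qt k) (bT _ _ Tt).
Qed.

Lemma ellQ0 : ellQ S_ T 0.
Proof.
split; first exact: psdmx0.
exists 0; first exact: ellitope0 eT.
by move=> k; rewrite mul0mx mxtrace0 mxE.
Qed.

Lemma le_Mstar2 Q : ellQ S_ T Q -> \tr (B *m Q *m B^T) <= Mstar S_ T B ^+ 2.
Proof.
have ub : has_ubound [set \tr (B *m Q *m B^T) | Q in ellQ S_ T].
  have [c cP] := ellQ_trace_bounded.
  exists (frob B * c) => _ [P eP <-]; have [psdP _] := eP.
  by rewrite (le_trans (psdmx_trace_le B psdP))// ler_wpM2l ?frob_ge0// cP.
move=> eQ; rewrite sqr_sqrtr; first by apply: ub_le_sup => //; exists Q.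
(* The supremum must be nonnegative for its square root to square back to it; the zero matrix
   witnesses this. *)
apply: (@le_trans _ _ (\tr (B *m 0 *m B^T))).
  by rewrite mulmx0 mul0mx mxtrace0.
by apply: ub_le_sup => //; exists 0 => //; exact: ellQ0.
Qed.

Lemma Mstar_ge0 : 0 <= Mstar S_ T B. Proof. exact: sqrtr_ge0. Qed.

Lemma ellitope_sqnorm2_le x : ellitope S_ T x ->
  sqnorm2 (B *m x) <= Mstar S_ T B ^+ 2.
Proof.
move=> [t Tt xt]; have eQ : ellQ S_ T (x *m x^T).
  split; first exact: psdmx_rank1.
  by exists t => // k; rewrite quad_rank1.
apply: le_trans (le_Mstar2 eQ); rewrite mulmxA -mulmxA -trmx_mul.
by rewrite -[X in \tr X]mulmx1 quad_rank1 quadE mul1mx sqnorm2E.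
Qed.

Lemma ellitope_contains0 : ellitope S_ T 0.
Proof.
exists 0; first exact: ellitope0 eT.
by move=> k; rewrite quadE dotC dot0r mxE.
Qed.

(** Let [Z > 1] be the largest ratio [quad (S_ k) x / t k 0]. Then [x / sqrt Z] lies in the
    ellitope, so the error is at most [4 * M2 * Z], and [Z <= exp (Z - 1) <= exp ((Z - 1) / (3
    kap))] as [3 * kap <= 1]. Summing over [k] replaces the maximum by terms with known Gaussian
    mean. *)
Lemma outside_ellitope_le (t : 'cV[R]_K) (x : 'cV[R]_n) (v : 'cV[R]_nu) kap :
  T t -> (forall k, 0 < t k 0) -> 0 < kap -> 3 * kap <= 1 ->
  sqnorm2 v <= Mstar S_ T B ^+ 2 -> ~ ellitope S_ T x ->
  sqnorm2 (v - B *m x) <= 4 * Mstar S_ T B ^+ 2 *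
    \sum_k expR ((quad (S_ k) x / t k 0 - 1) / (3 * kap)).
Proof.
move=> Tt t0 kap0 kap1 vM notX; set M2 := Mstar S_ T B ^+ 2 in vM *.
pose z k := quad (S_ k) x / t k 0.
have [k1 zk1] : exists k, 1 < z k.
  apply: contrapT => no; apply: notX; exists t => // k.
  rewrite -[leRHS]mul1r -ler_pdivrMr// leNgt; apply/negP => zk.
  by apply: no; exists k.
have [k0 _ zmax] := @arg_maxP _ _ _ k1 xpredT z isT.
set Z := z k0 in zmax.
have Z1 : 1 < Z by apply: lt_le_trans zk1 _; exact: zmax.
have M20 : 0 <= M2 by exact: sqr_ge0.
have sZ0 : 0 < Num.sqrt Z by rewrite sqrtr_gt0; lra.
have sZ2 : Num.sqrt Z ^+ 2 = Z by rewrite sqr_sqrtr//; lra.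
have yX : ellitope S_ T ((Num.sqrt Z)^-1 *: x).
  exists t => // k; rewrite quadE -scalemxAr dotZl dotZr -quadE mulrA -expr2.
  rewrite exprVn sZ2 mulrC ler_pdivrMr; last by lra.
  by rewrite mulrC -ler_pdivrMr//; exact: zmax.
have Bx : sqnorm2 (B *m x) <= Z * M2.
  have := ellitope_sqnorm2_le yX; rewrite -scalemxAr sqnorm2Z exprVn sZ2.
  by rewrite mulrC ler_pdivrMr ?[M2 * Z]mulrC//; lra.
have le4 : sqnorm2 (v - B *m x) <= 4 * M2 * Z.
  have : sqnorm2 (v - B *m x) <= 2 * sqnorm2 v + 2 * sqnorm2 (B *m x).
    by have := sqnorm2_ge0 (v + B *m x); rewrite sqnorm2B sqnorm2D; lra.
  have : M2 * 1 <= M2 * Z by rewrite ler_wpM2l//; lra.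
  lra.
apply: le_trans le4 _; rewrite ler_wpM2l//; first by rewrite mulr_ge0.
rewrite (bigD1 k0)//= -[leLHS]addr0 lerD//; last first.
  by apply: sumr_ge0 => k _; exact: expR_ge0.
apply: le_trans (expR_ge1Dx _); rewrite -/(z k0) -/Z.
have : Z - 1 <= (Z - 1) / (3 * kap).
  rewrite ler_pdivlMr; last by lra.
  by rewrite -[leRHS]mulr1 ler_wpM2l//; lra.
lra.
Qed.

End mstar.

Section risk_of_linear_estimate.
Context {R : realType} {m n nu K : nat}.
Variables (S_ : 'I_K -> 'M[R]_n) (T : set 'cV[R]_K).
Variables (A : 'M[R]_(m, n)) (B : 'M[R]_(nu, n)) (sigma : R) (S : 'M[R]_n).
Hypotheses (eT : ellitope_data S_ T) (psdS : psdmx S).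

Lemma mse_linear_estimate (H : 'M[R]_(m, nu)) x :
  (mse A B sigma (linear_estimate H) x =
   (sqnorm2 ((B - H^T *m A) *m x) + sigma ^+ 2 * frob H)%:E)%E.
Proof.
transitivity (\int[std_gaussian m]_t (sqnorm2
    (- ((B - H^T *m A) *m x) + (sigma *: H^T) *m col_of_tuple t))%:E)%E.
  apply: eq_integral => t _; congr (sqnorm2 _)%:E.
  rewrite /linear_estimate mulmxDr mulmxBl opprB -scalemxAr -scalemxAl mulmxA.
  by rewrite addrAC.
by rewrite integral_std_gaussian_sqnorm2 sqnorm2N frobZ frob_tr.
Qed.

Lemma RiskS_linear_estimate_le (tau : R) (H : 'M[R]_(m, nu)) lambda :
  feasible S_ T A B sigma S tau H lambda ->
  (RiskS A B sigma S (ellitope S_ T) (linear_estimate H) <=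
   (Num.sqrt tau)%:E)%E.
Proof.
move=> [psdM le l0]; apply: ereal_inf_lbound; exists tau => // x [t Tt xt].
rewrite mse_linear_estimate lee_fin.
have := (psdmx_block_pencil _ _ eT psdS _ _ _).1 psdM x.
have : \sum_k lambda k 0 * quad (S_ k) x <= phi T lambda.
  apply: le_trans (phi_ub eT l0 Tt).
  by apply: ler_sum => k _; rewrite ler_wpM2l.
move: le; rewrite trace_tr_mul; lra.
Qed.

(** If [tau <= 0], the noise term and [phi] vanish, so [H = 0] and, [t0] being positive,
    [lambda = 0]; the matrix inequality then forces [B = 0]. *)
Lemma feasible_gt0 (tau : R) (H : 'M[R]_(m, nu)) lambda : B != 0 -> 0 < sigma ->
  feasible S_ T A B sigma S tau H lambda -> 0 < tau.
Proof.
move=> B0 s0 [psdM le l0]; rewrite ltNge; apply/negP => tau0.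
have [t0 Tt0 [c c0 ct0]] := ellitope_pos eT.
have lt0 : dot lambda t0 <= phi T lambda by exact: (phi_ub eT l0 Tt0).
have dge k : 0 <= lambda k 0 * t0 k 0.
  by rewrite mulr_ge0// (le_trans (ltW c0)).
have d0 : 0 <= dot lambda t0 by apply: sumr_ge0 => k _.
have f0 : 0 <= sigma ^+ 2 * frob H by rewrite mulr_ge0 ?sqr_ge0 ?frob_ge0.
rewrite trace_tr_mul in le.
have dE : dot lambda t0 = 0 by lra.
have fE : sigma ^+ 2 * frob H = 0 by lra.
have HE : H = 0.
  apply: frob_eq0; apply/eqP; move/eqP: fE.
  by rewrite mulf_eq0 sqrf_eq0 gt_eqF.
have lE k : lambda k 0 = 0.
  move/eqP: dE; rewrite psumr_eq0// => /allP/(_ k).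
  rewrite mem_index_enum => /(_ isT); rewrite mulf_eq0 => /orP[/eqP//|].
  by rewrite gt_eqF// (lt_le_trans c0).
have Bx (x : 'cV[R]_n) : B *m x = 0.
  apply: sqnorm2_eq0; apply/eqP; rewrite eq_le sqnorm2_ge0 andbT.
  have := (psdmx_block_pencil _ _ eT psdS _ _ _).1 psdM x.
  rewrite HE trmx0 mul0mx subr0 big1 ?add0r => [/le_trans|k _].
    by apply; rewrite mulr_le0_ge0 ?psdS.2.
  by rewrite lE mul0r.
move/negP: B0; apply; apply/eqP/matrixP => i j.
by have /matrixP/(_ i 0) := Bx (delta_mx j 0); rewrite -colE !mxE.
Qed.

End risk_of_linear_estimate.

Section lower_bound.
Context {R : realType} {m n nu K : nat}.
Variables (S_ : 'I_K -> 'M[R]_n) (T : set 'cV[R]_K).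
Variables (A : 'M[R]_(m, n)) (B : 'M[R]_(nu, n)) (sigma : R) (S : 'M[R]_n).
Hypotheses (eT : ellitope_data S_ T) (sigma_gt0 : 0 < sigma) (psdS : psdmx S).
Local Notation tuples m := (m.-tuple (measurableTypeR R)).

(** Dividing the observation by [sigma] reduces this to [gaussian_bayes_risk] with standard noise;
    the posterior-mean estimate is linear and gives [H]. *)
Lemma gaussian_prior_risk (w : 'cV[R]_m -> 'cV[R]_nu) p (L : 'M[R]_(n, p)) :
  borel_fun w -> exists H : 'M[R]_(m, nu),
  ((frob ((B - H^T *m A) *m L) + sigma ^+ 2 * frob H)%:E <=
   \int[std_gaussian p]_g mse A B sigma w (L *m col_of_tuple g))%E.
Proof.
move=> mw; pose A1 := sigma^-1 *: (A *m L); pose B1 := B *m L.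
pose C := posterior_mean A1.
exists (sigma^-1 *: (B1 *m C))^T.
have sn0 : sigma != 0 by rewrite gt_eqF.
apply: (@le_trans _ _ (frob (B1 - B1 *m C *m A1) + frob (B1 *m C))%:E).
  rewrite lee_fin trmxK frob_tr frobZ mulrA -exprMn divff// expr1n mul1r.
  suff -> : B1 - B1 *m C *m A1 = (B - sigma^-1 *: (B1 *m C) *m A) *m L by [].
  by rewrite mulmxBl -!scalemxAl -scalemxAr !mulmxA.
apply: (le_trans (gaussian_bayes_risk A1 B1 (borel_scale sigma mw))).
rewrite le_eqVlt; apply/orP; left; apply/eqP.
apply: eq_integral => g _; apply: eq_integral => t _.
have -> : sigma *: (A1 *m col_of_tuple g + col_of_tuple t) =
    A *m (L *m col_of_tuple g) + sigma *: col_of_tuple t.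
  by rewrite scalerDr -scalemxAl scalerA divff// scale1r mulmxA.
by rewrite -mulmxA.
Qed.

Lemma measurable_loss (w : 'cV[R]_m -> 'cV[R]_nu) (x : 'cV[R]_n) :
  borel_fun w ->
  measurable_fun setT (fun t : tuples m =>
    (sqnorm2 (w (A *m x + sigma *: col_of_tuple t) - B *m x))%:E).
Proof.
move=> mw; apply/measurable_EFinP; apply: measurable_sqnorm2.
apply: measurable_sub_coord => i //.
apply: (measurableT_comp (borel_fun_coord i mw)).
apply: measurable_fun_borelV; apply: measurable_add_coord => // j.
apply: measurable_scale_coord => // k; exact: measurable_col_of_tuple.
Qed.

Lemma measurable_mse (w : 'cV[R]_m -> 'cV[R]_nu) p (L : 'M[R]_(n, p)) :
  borel_fun w -> measurable_fun setT (fun g : tuples p =>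
    mse A B sigma w (L *m col_of_tuple g)).
Proof.
move=> mw.
have mL i : measurable_fun setT (fun z : tuples p * tuples m =>
    (L *m col_of_tuple z.1) i 0 : measurableTypeR R).
  apply: measurable_mulmx_coord => j.
  exact: (measurableT_comp (measurable_col_of_tuple j)).
apply: (measurable_integral_std_gaussian (f := fun z : tuples p * tuples m =>
  (sqnorm2 (w (A *m (L *m col_of_tuple z.1) + sigma *: col_of_tuple z.2) -
            B *m (L *m col_of_tuple z.1)))%:E)); last first.
  by move=> z; rewrite lee_fin sqnorm2_ge0.
apply/measurable_EFinP; apply: measurable_sqnorm2.
apply: measurable_sub_coord => i; last exact: measurable_mulmx_coord.
apply: (measurableT_comp (borel_fun_coord i mw)).
apply: measurable_fun_borelV; apply: measurable_add_coord => j.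
  exact: measurable_mulmx_coord.
apply: measurable_scale_coord => // k.
exact: (measurableT_comp (measurable_col_of_tuple k)).
Qed.

Lemma mse_trunc_le (w : 'cV[R]_m -> 'cV[R]_nu) M (x : 'cV[R]_n) : 0 <= M ->
  borel_fun w -> sqnorm2 (B *m x) <= M ^+ 2 ->
  (mse A B sigma (fun v => trunc M (w v)) x <= mse A B sigma w x)%E.
Proof.
move=> M0 mw xM; apply: ge0_le_integral => //.
- by move=> t _; rewrite lee_fin sqnorm2_ge0.
- exact: (measurable_loss x (borel_trunc M0 mw)).
- exact: measurable_loss.
- by move=> t _; rewrite lee_fin sqnorm2_truncB.
Qed.

Lemma mse_ge0 (w : 'cV[R]_m -> 'cV[R]_nu) x : (0 <= mse A B sigma w x)%E.
Proof. by apply: integral_ge0 => t _; rewrite lee_fin sqnorm2_ge0. Qed.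

Lemma mse_le_cst (w : 'cV[R]_m -> 'cV[R]_nu) x c : borel_fun w ->
  (forall v, sqnorm2 (w v - B *m x) <= c) -> (mse A B sigma w x <= c%:E)%E.
Proof.
move=> mw wc; have c0 : 0 <= c by exact: le_trans (sqnorm2_ge0 _) (wc 0).
apply: (@le_trans _ _ (\int[std_gaussian m]_(_ in [set: tuples m]) c%:E)%E).
  apply: ge0_le_integral => //.
  - by move=> t _; rewrite lee_fin sqnorm2_ge0.
  - exact: measurable_loss.
  - by move=> t _; rewrite lee_fin.
by rewrite integral_cst//= [X in (_ * X)%E]probability_setT mule1.
Qed.

Lemma risk_lower_bound (w : 'cV[R]_m -> 'cV[R]_nu) tw Q tau1 kap eps :
  borel_fun w ->
  (forall x, ellitope S_ T x -> (mse A B sigma w x <= (tw * (1 + quad S x))%:E)%E) ->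
  ellQ S_ T Q ->
  (forall H, tau1 * (1 + \tr (Q *m S)) <= linear_mse A B sigma H Q) ->
  0 < kap -> 3 * kap <= 1 -> 0 < eps < 1 ->
  (1 - eps) * kap * tau1 <=
    tw + 4 * Mstar S_ T B ^+ 2 * K%:R * Num.sqrt 3 * expR (- (3 * kap)^-1).
Proof.
move=> mw risk [psdQ [t Tt Qt]] lmse kap0 kap1 /andP[eps0 eps1].
set M := Mstar S_ T B; have M0 : 0 <= M by exact: Mstar_ge0.
(* The signal has covariance [k1 *: Q]. The factor [1 - eps] pays for replacing [t] by the strictly
   positive [t'], so that its trace against [S_ k] is at most [kap * t' k 0]. *)
pose k1 := (1 - eps) * kap.
have k10 : 0 < k1 by rewrite mulr_gt0// subr_gt0.
have k11 : k1 <= 1.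
  have : (1 - eps) * kap <= 1 * kap by rewrite ler_wpM2r ?(ltW kap0)//; lra.
  rewrite /k1; lra.
have [G QE] := psdmx_factor psdQ.
pose L := Num.sqrt k1 *: G^T.
have LL p (X : 'M[R]_(p, n)) : frob (X *m L) = k1 * \tr (X *m Q *m X^T).
  by rewrite -scalemxAr frobZ sqr_sqrtr ?(ltW k10)// QE trace_factor.
have [t0 Tt0 [c c0 ct0]] := ellitope_pos eT.
pose t' := (1 - eps) *: t + eps *: t0.
have Tt' : T t' by apply: (ellitope_mix eT) => //; rewrite !ltW.
have t'_ge k : (1 - eps) * t k 0 <= t' k 0.
  rewrite !mxE lerDl mulr_ge0 ?(ltW eps0)//.
  by rewrite (le_trans (ltW c0)).
have t'_gt0 k : 0 < t' k 0.
  rewrite !mxE ltr_wpDl//; last by rewrite mulr_gt0// (lt_le_trans c0).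
  by rewrite mulr_ge0 ?subr_ge0 ?(ltW eps1)// (ell_nneg eT Tt).
have tw0 : 0 <= tw.
  have := risk 0 (ellitope_contains0 eT).
  rewrite quadE dotC dot0r addr0 mulr1 => /(le_trans (mse_ge0 w 0)).
  by rewrite lee_fin.
pose w' v := trunc M (w v).
have mw' : borel_fun w' by exact: borel_trunc.
pose x g : 'cV[R]_n := L *m col_of_tuple g.
pose e k (g : tuples n) := expR ((quad (S_ k) (x g) / t' k 0 - 1) / (3 * kap)).
have mx i : measurable_fun setT (fun g : tuples n => x g i 0 : measurableTypeR R).
  by apply: measurable_mulmx_coord => j; exact: measurable_col_of_tuple.
have mquad (P : 'M[R]_n) : measurable_fun setT
    (fun g : tuples n => quad P (x g) : measurableTypeR R).
  under eq_fun do rewrite quadE.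
  apply: measurable_sum => i; apply: measurable_funM; first exact: mx.
  by apply: measurable_mulmx_coord => j; exact: mx.
have me k : measurable_fun setT (fun g => (e k g)%:E).
  apply/measurable_EFinP; apply: measurableT_comp => //.
  apply: measurable_funM => //; apply: measurable_funB => //.
  by apply: measurable_funM => //; exact: mquad.
have M40 : 0 <= 4 * M ^+ 2 by rewrite mulr_ge0 ?sqr_ge0.
have e_ge0 k g : 0 <= e k g by exact: expR_ge0.
have bound g : (mse A B sigma w' (x g) <=
    (tw * (1 + quad S (x g)))%:E +
    \sum_k (4 * M ^+ 2)%:E * (e k g)%:E)%E.
  have q0 : (0 <= (tw * (1 + quad S (x g)))%:E)%E.
    by rewrite lee_fin mulr_ge0// addr_ge0// psdS.2.
  have e0 : (0 <= \sum_k (4 * M ^+ 2)%:E * (e k g)%:E)%E.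
    by apply: sume_ge0 => k _; rewrite -EFinM lee_fin !mulr_ge0 ?expR_ge0.
  (* Inside the signal set truncation does no harm and [risk] applies; outside, only the truncation
     bounds the error. *)
  have [xX|nX] := pselect (ellitope S_ T (x g)).
    rewrite -[leLHS]adde0 leeD//.
    apply: le_trans (risk _ xX); apply: mse_trunc_le => //.
    exact: (ellitope_sqnorm2_le B eT xX).
  rewrite -[leLHS]add0e leeD//.
  under eq_bigr do rewrite -EFinM; rewrite sumEFin -mulr_sumr.
  apply: mse_le_cst => // v.
  apply: (outside_ellitope_le eT Tt') => //.
  exact: sqnorm2_trunc.
have Ie k : (\int[std_gaussian n]_g (e k g)%:E <=
    (Num.sqrt 3 * expR (- (3 * kap)^-1))%:E)%E.
  have [P SE] := psdmx_factor (ell_psd eT k).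
  (* This scaling gives [frob W <= 1] and turns the random part of the exponent into
     [sqnorm2 (W *m col_of_tuple g) / 3]. *)
  pose s := (Num.sqrt (kap * t' k 0))^-1.
  have kt0 : 0 < kap * t' k 0 by rewrite mulr_gt0.
  have s2 : s ^+ 2 = (kap * t' k 0)^-1 by rewrite exprVn sqr_sqrtr// ltW.
  pose W := s *: (P *m L).
  have W1 : frob W <= 1.
    rewrite frobZ LL s2 mulrC ler_pdivrMr// mul1r -mxtrace_mulC mulmxA -SE.
    rewrite mxtrace_mulC /k1 mulrAC mulrC ler_wpM2l ?(ltW kap0)//.
    by rewrite (le_trans _ (t'_ge k))// ler_wpM2l ?Qt// subr_ge0 ltW.
  have eE g : e k g = expR (- (3 * kap)^-1) *
      expR (sqnorm2 (W *m col_of_tuple g) / 3).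
    rewrite -expRD; congr expR.
    rewrite -scalemxAl sqnorm2Z s2 -mulmxA -/(x g).
    have -> : sqnorm2 (P *m x g) = quad (S_ k) (x g).
      by rewrite quadE SE -mulmxA dot_mulmxr trmxK sqnorm2E.
    by have := t'_gt0 k => tk0; field; rewrite !gt_eqF.
  under eq_integral do rewrite eE EFinM.
  rewrite ge0_integralZl_EFin//; last first.
    apply/measurable_EFinP; apply: measurableT_comp => //.
    apply: measurable_funM => //; apply: measurable_sqnorm2.
    by apply: measurable_mulmx_coord; exact: measurable_col_of_tuple.
  rewrite [Num.sqrt 3 * _]mulrC EFinM; apply: lee_wpmul2l.
    by rewrite lee_fin expR_ge0.
  exact: integral_expR_sqnorm2_le.
have [H HP] := gaussian_prior_risk L mw'.
(* Passing from [Q] to [k1 *: Q] shrinks the signal term only; the noise term is kept whole, and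
   [k1 <= 1]. *)
have lower : k1 * (tau1 * (1 + \tr (Q *m S))) <=
    frob ((B - H^T *m A) *m L) + sigma ^+ 2 * frob H.
  rewrite LL; apply: (@le_trans _ _ (k1 * linear_mse A B sigma H Q)).
    by rewrite ler_wpM2l ?(ltW k10).
  rewrite /linear_mse mulrDr lerD2l -[leRHS]mul1r ler_wpM2r//.
  by rewrite mulr_ge0 ?sqr_ge0 ?frob_ge0.
have Iquad : (\int[std_gaussian n]_g (tw * (1 + quad S (x g)))%:E =
    (tw * (1 + k1 * \tr (Q *m S)))%:E)%E.
  have [P SE] := psdmx_factor psdS.
  under eq_integral do rewrite EFinM EFinD.
  rewrite ge0_integralZl_EFin//; last 2 first.
  - by move=> g _; rewrite -EFinD lee_fin addr_ge0// psdS.2.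
  - by apply: emeasurable_funD => //; apply/measurable_EFinP; exact: mquad.
  rewrite EFinM; congr (_ * _)%E.
  rewrite ge0_integralD//; last 2 first.
  - by move=> g _; rewrite lee_fin psdS.2.
  - by apply/measurable_EFinP; exact: mquad.
  rewrite integral_cst//= [X in (_ * X)%E]probability_setT mule1 EFinD.
  congr (_ + _)%E.
  have -> : k1 * \tr (Q *m S) = frob (P *m L).
    by rewrite LL SE [in LHS]mulmxA mxtrace_mulC mulmxA.
  rewrite -[frob _]add0r -(@sqnorm20 R n) -integral_std_gaussian_sqnorm2.
  apply: eq_integral => g _; congr EFin; rewrite add0r -mulmxA -/(x g).
  by rewrite quadE SE -mulmxA dot_mulmxr trmxK sqnorm2E.
have upper : (\int[std_gaussian n]_g mse A B sigma w' (x g) <=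
   (tw * (1 + k1 * \tr (Q *m S)) +
    4 * M ^+ 2 * K%:R * Num.sqrt 3 * expR (- (3 * kap)^-1))%:E)%E.
  apply: (@le_trans _ _ (\int[std_gaussian n]_g
     ((tw * (1 + quad S (x g)))%:E + \sum_k (4 * M ^+ 2)%:E * (e k g)%:E))%E).
    apply: ge0_le_integral => //.
    - by move=> g _; exact: mse_ge0.
    - exact: measurable_mse.
    - apply: emeasurable_funD; last first.
        by apply: emeasurable_sum => k; exact: emeasurable_funM.
      apply/measurable_EFinP; apply: measurable_funM => //.
      by apply: measurable_funD => //; exact: mquad.
  rewrite ge0_integralD//; first last.
  - by apply: emeasurable_sum => k; exact: emeasurable_funM.
  - move=> g _; apply: sume_ge0 => k _.
    by rewrite -EFinM lee_fin (mulr_ge0 M40 (e_ge0 k g)).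
  - apply/measurable_EFinP; apply: measurable_funM => //.
    by apply: measurable_funD => //; exact: mquad.
  - by move=> g _; rewrite lee_fin mulr_ge0// addr_ge0// psdS.2.
  rewrite Iquad EFinD leeD2l// ge0_integral_sum//; last 2 first.
  - by move=> k; exact: emeasurable_funM.
  - by move=> k g _; rewrite -EFinM lee_fin (mulr_ge0 M40 (e_ge0 k g)).
  apply: (@le_trans _ _ (\sum_(k < K)
      (4 * M ^+ 2 * (Num.sqrt 3 * expR (- (3 * kap)^-1)))%:E)%E).
    apply: lee_sum => k _; rewrite ge0_integralZl_EFin//.
    - by rewrite [leRHS]EFinM; apply: lee_wpmul2l => //; rewrite lee_fin.
    - by move=> g _; rewrite lee_fin.
  rewrite sumEFin lee_fin sumr_const card_ord -mulr_natl.
  by rewrite le_eqVlt; apply/orP; left; apply/eqP; ring.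
have trQS := psdmx_trace_mul_ge0 psdQ psdS.
have : k1 * (tau1 * (1 + \tr (Q *m S))) <= tw * (1 + k1 * \tr (Q *m S)) +
    4 * M ^+ 2 * K%:R * Num.sqrt 3 * expR (- (3 * kap)^-1).
  by rewrite -lee_fin; apply: le_trans upper; apply: le_trans HP; rewrite lee_fin.
set ex := 4 * _ * _ * _ * _ => main.
have ex0 : 0 <= ex.
  by rewrite /ex !mulr_ge0 ?expR_ge0 ?sqrtr_ge0.
have trS1 : 0 < 1 + \tr (Q *m S) by lra.
rewrite -/k1 -(ler_pM2r trS1).
have : tw * (k1 * \tr (Q *m S)) <= tw * \tr (Q *m S).
  by rewrite ler_wpM2l// -[leRHS]mul1r ler_wpM2r.
have : 0 <= ex * \tr (Q *m S) by rewrite mulr_ge0.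
by move: main; rewrite -[k1 * tau1 * _]mulrA; lra.
Qed.

End lower_bound.

Section optimal_risk.
Context {R : realType} {m n nu K : nat}.
Variables (S_ : 'I_K -> 'M[R]_n) (T : set 'cV[R]_K).
Variables (A : 'M[R]_(m, n)) (B : 'M[R]_(nu, n)) (sigma : R) (S : 'M[R]_n).
Hypotheses (eT : ellitope_data S_ T) (sigma_gt0 : 0 < sigma) (psdS : psdmx S).
Local Notation X := (ellitope S_ T).
Local Notation M := (Mstar S_ T B).

Lemma RiskS_ge0 w : (0 <= RiskS A B sigma S X w)%E.
Proof. by apply/ereal_infP => _ [t _ <-]; rewrite lee_fin sqrtr_ge0. Qed.

Lemma RiskSopt_ge0 : (0 <= RiskSopt A B sigma S X)%E.
Proof. by apply/ereal_infP => _ [w _ <-]; exact: RiskS_ge0. Qed.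

(** Attained by the zero estimate; it also makes the optimal risk finite. *)
Lemma RiskSopt_le_Mstar : (RiskSopt A B sigma S X <= M%:E)%E.
Proof.
have b0 : borel_fun (fun _ : 'cV[R]_m => 0 : 'cV[R]_nu) by exact: measurable_cst.
apply: (@le_trans _ _ (RiskS A B sigma S X (fun=> 0))).
  by apply: ereal_inf_lbound; exists (fun=> 0).
apply: ereal_inf_lbound; exists (M ^+ 2); last first.
  by rewrite sqrtr_sqr ger0_norm// Mstar_ge0.
move=> x xX; apply: mse_le_cst => // v; rewrite sub0r sqnorm2N.
apply: le_trans (ellitope_sqnorm2_le B eT xX) _.
by rewrite -[leLHS]mulr1 ler_wpM2l ?sqr_ge0// lerDl psdS.2.
Qed.

Lemma RiskSopt_fin : RiskSopt A B sigma S X = (fine (RiskSopt A B sigma S X))%:E.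
Proof.
rewrite fineK// ge0_fin_numE; last exact: RiskSopt_ge0.
by apply: le_lt_trans RiskSopt_le_Mstar _; rewrite ltry.
Qed.

(** One factor 39/40 is lost to a nearly optimal dual point, the other to [eps = 1 / 40]. *)
Lemma optimal_le_RiskSopt tau H lambda kap :
  optimal S_ T A B sigma S tau H lambda -> 0 < tau ->
  0 < kap -> 3 * kap <= 1 ->
  (39 / 40) ^+ 2 * kap * tau <= fine (RiskSopt A B sigma S X) ^+ 2 +
    4 * M ^+ 2 * K%:R * Num.sqrt 3 * expR (- (3 * kap)^-1).
Proof.
move=> opt tau0 kap0 kap1.
have [||Q eQ lmse] := optimal_dual eT sigma_gt0 psdS (tau1 := 39 / 40 * tau) opt.
- lra.
- lra.
set r := fine _; set ex := 4 * _ * _ * _ * _.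
have r0 : 0 <= r by rewrite fine_ge0// RiskSopt_ge0.
rewrite -lerBlDr leNgt; apply/negP; set y := (y in _ < y) => ry.
have y0 : 0 <= y by rewrite (le_trans _ (ltW ry))// sqr_ge0.
have rsy : r < Num.sqrt y.
  by rewrite -(@ltr_pXn2r _ 2)// ?nnegrE ?sqrtr_ge0// sqr_sqrtr.
have : (RiskSopt A B sigma S X < (Num.sqrt y)%:E)%E.
  by rewrite RiskSopt_fin lte_fin.
move=> /ereal_inf_lt[_ [w mw <-]] /ereal_inf_lt[_ [tw /= risk <-]].
rewrite lte_fin => twy.
have := risk_lower_bound eT sigma_gt0 psdS (eps := 1 / 40) mw risk eQ lmse kap0 kap1.
move=> /(_ _); rewrite -/ex => le.
have {le} : y <= tw.
  rewrite /y lerBlDr; apply: le_trans (le _); last by lra.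
  by rewrite le_eqVlt; apply/orP; left; apply/eqP; field.
rewrite leNgt => /negP; apply.
have [tw0|tw0] := leP 0 tw.
  by rewrite -(sqr_sqrtr tw0) -(sqr_sqrtr y0) ltr_pXn2r ?nnegrE ?sqrtr_ge0.
exact: (lt_le_trans tw0 y0).
Qed.

(** With zero risk and [kap = 1 / (3 * u)], the lower bound reads [a / (3 u) <= c * exp (- u)].
    Since [exp u >= u^2 / 4], this gives [a * u <= 12 * c], which the choice of [u] violates. *)
Lemma RiskSopt_gt0 tau H lambda :
  optimal S_ T A B sigma S tau H lambda -> 0 < tau ->
  0 < fine (RiskSopt A B sigma S X).
Proof.
move=> opt tau0; have r0 : 0 <= fine (RiskSopt A B sigma S X).
  by rewrite fine_ge0// RiskSopt_ge0.
rewrite lt_neqAle r0 andbT eq_sym; apply/negP => /eqP rE.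
pose c := 4 * M ^+ 2 * K%:R * Num.sqrt 3.
have c0 : 0 <= c by rewrite /c !mulr_ge0 ?sqrtr_ge0.
pose a := (39 / 40) ^+ 2 * tau.
have a0 : 0 < a by rewrite mulr_gt0// exprn_gt0//; lra.
pose u := 1 + 12 * c / a.
have u1 : 1 <= u by rewrite lerDl divr_ge0 ?(ltW a0)// mulr_ge0.
have u0 : 0 < u by lra.
have kE : (3 * (3 * u)^-1)^-1 = u by field; lra.
have k0 : 0 < (3 * u)^-1 by rewrite invr_gt0; lra.
have k1 : 3 * (3 * u)^-1 <= 1.
  by rewrite -[leLHS]invrK kE invf_le1.
have := optimal_le_RiskSopt opt tau0 k0 k1.
rewrite kE rE expr0n/= add0r -/c => main.
have e1 : expR (- u) * (u ^+ 2 / 4) <= 1.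
  have h : u / 2 <= expR (u / 2) by have := expR_ge1Dx (u / 2); lra.
  have h2 : u ^+ 2 / 4 <= expR u.
    have -> : u ^+ 2 / 4 = (u / 2) ^+ 2 by field.
    have -> : expR u = expR (u / 2) ^+ 2 by rewrite expr2 -expRD; congr expR; field.
    by rewrite lerXn2r// nnegrE ?expR_ge0//; lra.
  have uu : expR (- u) * expR u = 1 by rewrite -expRD addNr expR0.
  by rewrite -[leRHS]uu ler_wpM2l ?expR_ge0.
have {main} : a * u <= 12 * c.
  have h : 0 <= 3 * u * (u / 4) by rewrite mulr_ge0//; lra.
  have := ler_wpM2r h main.
  have -> : (39 / 40) ^+ 2 * (3 * u)^-1 * tau * (3 * u * (u / 4)) = a * u / 4.
    by rewrite /a; field; rewrite gt_eqF.
  have -> : c * expR (- u) * (3 * u * (u / 4)) =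
    3 * (c * (expR (- u) * (u ^+ 2 / 4))) by field.
  have : c * (expR (- u) * (u ^+ 2 / 4)) <= c * 1 by rewrite ler_wpM2l.
  lra.
have -> : a * u = a + 12 * c by rewrite /u; field; rewrite gt_eqF.
lra.
Qed.

End optimal_risk.

(** For [K = 0] the empty sum is positive definite only in dimension 0, where [B] would be zero. *)
Lemma ellitope_index_gt0 (R : realType) n nu K (S_ : 'I_K -> 'M[R]_n)
    (T : set 'cV[R]_K) (B : 'M[R]_(nu, n)) :
  ellitope_data S_ T -> B != 0 -> (0 < K)%N.
Proof.
case: K S_ T => // S_ T eT /negP[]; apply/eqP/matrixP => i j.
have [_ /(_ (delta_mx j 0))] := ell_sum_pd eT.
rewrite big_ord0 quadE mul0mx dot0r ltxx => pd.
suff : false by [].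
apply: pd; apply/eqP => /colP/(_ j); rewrite !mxE !eqxx => /eqP.
by rewrite oner_eq0.
Qed.

(** Ensures [3 * kap <= 1] in the final choice. Here [exp (1/2) <= 2] comes from
    [exp (-1/2) >= 1/2], so [e <= 4]. *)
Lemma ln_ge1 (R : realType) (x : R) : 8 <= x -> 1 <= ln x.
Proof.
move=> x8; rewrite -[leLHS]expRK ler_ln ?posrE ?expR_gt0//; last by lra.
apply: le_trans x8.
have -> : expR 1 = expR (1 / 2) ^+ 2 :> R.
  by rewrite expr2 -expRD; congr expR; field.
have h : expR (1 / 2) <= 2 :> R.
  have e0 : 0 < expR (1 / 2) :> R by exact: expR_gt0.
  have := expR_ge1Dx (- (1 / 2) : R); rewrite expRN => h.
  have : expR (1 / 2) * (1 + - (1 / 2)) <= expR (1 / 2) * (expR (1 / 2))^-1 :> R.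
    by rewrite ler_wpM2l ?(ltW e0).
  by rewrite divff ?gt_eqF//; lra.
apply: (@le_trans _ _ (2 ^+ 2)); last by lra.
by rewrite lerXn2r// nnegrE ?expR_ge0.
Qed.

Theorem proposition3p1 (R : realType) (m n nu K : nat)
    (S_ : 'I_K -> 'M[R]_n) (T : set 'cV[R]_K)
    (A : 'M[R]_(m, n)) (B : 'M[R]_(nu, n)) (sigma : R) (S : 'M[R]_n)
    (tau : R) (Hstar : 'M[R]_(m, nu)) (lambda : 'cV[R]_K) :
  ellitope_data S_ T ->
  B != 0 ->
  0 < sigma ->
  psdmx S ->
  optimal S_ T A B sigma S tau Hstar lambda ->
  let X := ellitope S_ T in
  let ropt := RiskSopt A B sigma S X in
  (RiskS A B sigma S X (linear_estimate Hstar) <=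
   (Num.sqrt (6 * ln (8 * K%:R * Mstar S_ T B ^+ 2 / fine ropt ^+ 2)))%:E
     * ropt)%E.
Proof.
move=> eT B0 s0 psdS opt; lazy zeta.
set X := ellitope S_ T; set ropt := RiskSopt A B sigma S X.
have K0 := ellitope_index_gt0 eT B0.
have [feas _] := opt.
have tau0 := feasible_gt0 eT psdS B0 s0 feas.
have r0 := RiskSopt_gt0 eT s0 psdS opt tau0.
have rM := RiskSopt_le_Mstar A B sigma eT psdS.
have rE := RiskSopt_fin A B sigma eT psdS.
rewrite -/X -/ropt in r0 rM rE.
set M := Mstar S_ T B in rM *.
set r := fine ropt in r0 rE *.
rewrite rE lee_fin in rM.
pose q := 8 * K%:R * M ^+ 2 / r ^+ 2.
have K1 : 1 <= K%:R :> R by rewrite ler1n.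
have r2 : 0 < r ^+ 2 by rewrite exprn_gt0.
have rM2 : r ^+ 2 <= M ^+ 2 by rewrite lerXn2r// nnegrE ?(ltW r0)// (le_trans (ltW r0)).
have M2 : 0 < M ^+ 2 by exact: lt_le_trans rM2.
have q8 : 8 <= q.
  rewrite ler_pdivlMr// -[_ * K%:R * _]mulrA ler_wpM2l//.
  by rewrite -[leLHS]mul1r ler_pM// ltW.
have L1 := ln_ge1 q8.
set Lq := ln q in L1.
have L0 : 0 < Lq by lra.
have kE : (3 * (3 * Lq)^-1)^-1 = Lq by field; lra.
have k0 : 0 < (3 * Lq)^-1 by rewrite invr_gt0; lra.
have k1 : 3 * (3 * Lq)^-1 <= 1 by rewrite -[leLHS]invrK kE invf_le1.
have := optimal_le_RiskSopt eT s0 psdS opt tau0 k0 k1.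
rewrite -/X -/ropt -/r -/M kE expRN lnK; last by rewrite posrE; lra.
(* [kap = 1 / (3 * Lq)] makes the tail factor exactly [1 / q], and the 8 in [q] leaves a fixed
   multiple of [r ^+ 2]. *)
have -> : 4 * M ^+ 2 * K%:R * Num.sqrt 3 * q^-1 = Num.sqrt 3 / 2 * r ^+ 2.
  rewrite /q; field.
  by rewrite (gt_eqF r0) -sqrf_eq0 (gt_eqF M2) gt_eqF// (lt_le_trans ltr01).
move=> main.
have s3 : Num.sqrt 3 <= 7 / 4 :> R.
  rewrite -[leRHS]ger0_norm; last by lra.
  by rewrite -sqrtr_sqr ler_wsqrtr//; lra.
(* Numerically, [3 * (1 + 7 / 8) / (39 / 40)^2] is about 5.92. *)
have tau_le : tau <= 6 * Lq * r ^+ 2.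
  have {}main : (39 / 40) ^+ 2 * tau <= 3 * Lq * (r ^+ 2 + Num.sqrt 3 / 2 * r ^+ 2).
    have L3 : 0 <= 3 * Lq by lra.
    have := ler_wpM2l L3 main.
    suff -> : 3 * Lq * ((39 / 40) ^+ 2 * (3 * Lq)^-1 * tau) =
      (39 / 40) ^+ 2 * tau by [].
    by field; lra.
  have Lr : 0 < Lq * r ^+ 2 by rewrite mulr_gt0.
  have : Num.sqrt 3 * (Lq * r ^+ 2) <= 7 / 4 * (Lq * r ^+ 2).
    by rewrite ler_wpM2r// ltW.
  lra.
apply: le_trans (RiskS_linear_estimate_le eT psdS feas) _.
rewrite rE -EFinM lee_fin -/q -/Lq -[X in _ * X]ger0_norm ?(ltW r0)//.
rewrite -sqrtr_sqr -sqrtrM; last by rewrite mulr_ge0// ltW.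
exact: ler_wsqrtr.
Qed.
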